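(* Let $(D_n)_{n\ge1}$ be connected regular domains of the family $\mathcal D$ such that $x_0\in D_1$, $D_n\Subset D_{n+1}$ for all $n$, and $D=\bigcup_{n\ge1}D_n$, and suppose that for every $n$ the relative kernel $K_{D_n}$ has a jointly continuous version on $D_n\times\partial D_n$ (this version is used). Let $h\in\mathcal E(D)$ and $d\nu_n=h\,d\omega_{x_0}^{D_n}$ on $\partial D_n$. With $L_m$, $\mathcal Q_m$, $P$ and $T_n$ as defined in the context, let, for $n\ge m+2$, $T_{n,m}:\partial D_n\to\mathcal Q_m$, $T_{n,m}(y)=K_{D_n}(\cdot,y)|_{L_m}$, and $\rho_n^{(m)}=(T_{n,m})_\#\nu_n$; let also $\rho_n^h=(T_n)_\#\nu_n$. Then for every fixed $m$, $$\rho_n^{(m)}\Longrightarrow\delta_{h|_{L_m}}\quad\text{weakly on }\mathcal Q_m\quad(n\to\infty).$$ Moreover, $\rho_n^h\Longrightarrow\delta_h$ weakly on $P$.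
   Context: Let $X$ be a metric space. A domain is a nonempty connected open set; $V\Subset U$ means that $\overline V$ is compact and contained in $U$. Measures are positive Borel measures (completed when integrable functions are considered). A harmonic measure on a domain $U$ with $\partial U\ne\varnothing$ is a family $\{\omega_x^U:x\in U\}$ of measures on $\partial U$ with $\omega_x^U(\partial U)=1$ and $\omega_x^U\ll\omega_y^U$ for all $x,y\in U$; write $\omega_x^U(f)=\int_{\partial U}f\,d\omega_x^U$. It is continuous if $x\mapsto\omega_x^U(f)$ is continuous on $U$ for every $f\in\bigcap_{x\in U}L^1(\partial U,\omega_x^U)$, and Radon if every $\omega_x^U$ is Radon. The domain $U$ is regular if for every $\zeta\in\partial U$ and every bounded Borel $f$ on $\partial U$ continuous at $\zeta$ one has $\omega_x^U(f)\to f(\zeta)$ as $U\ni x\to\zeta$. Standing framework: $\mathcal D$ is a family of domains of $X$, each with nonempty boundary and equipped with a continuous Radon harmonic measure, such that (i) every $U\in\mathcal D$ is the union of an increasing sequence of regular domains of $\mathcal D$ whose closures are compact and contained in $U$; (ii) for $V\Subset U$ in $\mathcal D$ with $V$ regular, $\omega_x^U(f)=\int_{\partial V}\omega_y^U(f)\,d\omega_x^V(y)$ for all $x\in V$ and all bounded Borel $f$ on $\partial U$. $D\subseteq X$ is a domain and $x_0\in D$ is fixed. A function $u:W\to\mathbb R$ on an open set $W$ is harmonic if it is continuous and $u(x)=\int_{\partial V}u\,d\omega_x^V$ for every regular $V\in\mathcal D$ with $V\Subset W$ and every $x\in V$. $\mathcal H_1(D)$ is the set of strictly positive harmonic functions $h$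 on $D$ with $h(x_0)=1$, with the topology of locally uniform convergence, and $\mathcal E(D)$ is its set of extreme points (equivalently, the $h\in\mathcal H_1(D)$ that are minimal: every harmonic $v$ with $0\le v\le h$ equals $ch$ for some $c\in[0,1]$). For regular $U\in\mathcal D$ with $U\Subset D$, $x_0\in U$, $K_U(x,y)=\frac{d\omega_x^U}{d\omega_{x_0}^U}(y)$. Compact product: put $L_m=\overline{D_m}$, $a_m=\min_{L_m\times\partial D_{m+1}}K_{D_{m+1}}>0$, $b_m=\max_{L_m\times\partial D_{m+1}}K_{D_{m+1}}$, $\Omega_m(s,t)=\max_{z\in\partial D_{m+1}}|K_{D_{m+1}}(s,z)-K_{D_{m+1}}(t,z)|$. Let $\mathcal Q_m\subset C(L_m)$ (uniform norm) be the compact convex set of all $g\in C(L_m)$ that are harmonic in $D_m$, satisfy $g(x_0)=1$, and satisfy $a_i\le g(s)\le b_i$ and $|g(s)-g(t)|\le\Omega_i(s,t)$ for all $s,t\in L_i$ and all $i\le m$. It contains $g|_{L_m}$ for $g\in\mathcal H_1(D)$, the constant $1$, and $K_{D_n}(\cdot,y)|_{L_m}$ for $n\ge m+2$, $y\in\partial D_n$. Put $P=\prod_{m\ge1}\mathcal Q_m$ and identify $\mathcal H_1(D)$ with the closed subset of $P$ of sequences compatible under restriction, via $g\mapsto(g|_{L_m})_m$. Define $T_n:\partial D_n\to P$ by $T_n(y)_m=K_{D_n}(\cdot,y)|_{L_m}$ if $m\le n-2$ and $T_n(y)_m=1$ if $m>n-2$. $\Longrightarrow$ denotes weak convergence of finite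 measures against continuous functions on a compact space; $f_\#\mu$ is the push-forward. *)

(* Defs.v *)
From HB Require Import structures.
From mathcomp Require Import all_boot all_order all_algebra.
From mathcomp Require Import all_classical all_reals all_analysis.

Set Implicit Arguments.
Unset Strict Implicit.
Unset Printing Implicit Defensive.

Import Order.TTheory GRing.Theory Num.Theory.
Import numFieldNormedType.Exports.

Local Open Scope classical_set_scope.
Local Open Scope ring_scope.

(* [g_sigma_algebraType] needs a pointed carrier: [t0] only serves as the
   distinguished point, the sigma-algebra does not depend on it. *)
Definition pointed_at (T : topologicalType) (t0 : T) : Type := T.

HB.instance Definition _ (T : topologicalType) (t0 : T) :=
  Choice.on (pointed_at t0).
HB.instance Definition _ (T : topologicalType) (t0 : T) :=
  isPointed.Build (pointed_at t0) t0.

Definition borel_sets (T : topologicalType) (t0 : T)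
  : set (set (pointed_at t0)) := @open T.
Arguments borel_sets {T} t0.

Notation borel t0 := (g_sigma_algebraType (borel_sets t0)).

Section topology.
Context {T : topologicalType}.

Definition domain (U : set T) := [/\ U !=set0, connected U & open U].

Definition frontier (U : set T) := closure U `\` interior U.

Definition relatively_compact_in (V U : set T) :=
  compact (closure V) /\ closure V `<=` U.

End topology.

Section measures.
Context {R : realType} {T : topologicalType} {t0 : T}.

Definition radon (mu : {measure set (borel t0) -> \bar R}) :=
  (forall x : T, exists V : set T, open_nbhs x V /\ (mu V < +oo)%E) /\
  (forall A : set (borel t0), measurable A ->
    mu A = ereal_sup
      [set mu K | K in [set K : set T | compact K /\ K `<=` A]]).

(* Weak convergence, on the subspace [S] of [T], of Borel measures on [S];
   these are represented by the Borel measures on [T] carried by [S].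
   Integrals over [S] only see the values of [Phi] on [S]. *)
Definition weak_cvg_on (S : set T)
    (mu : nat -> set (borel t0) -> \bar R) (nu : set (borel t0) -> \bar R) :=
  [/\ forall n, mu n (~` S) = 0%E,
      nu (~` S) = 0%E &
      forall Phi : T -> R, {within S, continuous Phi} ->
        (\int[mu n]_(x in S) (Phi x)%:E)%E @[n --> \oo] -->
        (\int[nu]_(x in S) (Phi x)%:E)%E].

End measures.

(* For the probability measures below, the Caratheodory extension is the
   completion. *)
Definition completion d (T : measurableType d) (R : realType)
    (mu : {measure set T -> \bar R}) :=
  [the {measure set (caratheodory_type (mu^*)%mu) -> \bar R} of
     @completed_measure_extension d T R mu].

Section harmonic_measures.
Context {R : realType} {X : metricType R} {x0 : X}.

(* A measure on [frontier U] is represented by the Borel measure on [X] it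
   induces, which is carried by [frontier U]; functions on [frontier U] are
   total functions, of which only the values on [frontier U] are used. *)
Definition harmonic_measure (U : set X)
    (w : X -> {measure set (borel x0) -> \bar R}) :=
  (forall x, U x -> w x (~` frontier U) = 0%E /\ w x (frontier U) = 1%E) /\
  (forall x y, U x -> U y -> w x `<< w y).

Definition continuous_harmonic_measure (U : set X)
    (w : X -> {measure set (borel x0) -> \bar R}) :=
  forall f : X -> R,
    (forall x, U x ->
      (completion (w x)).-integrable (frontier U)
        (fun y => (f y)%:E)) ->
    {within U, continuous
      (fun x => \int[completion (w x)]_(y in frontier U) f y)}.

Definition bounded_borel (A : set X) (f : X -> R) :=
  measurable_fun (A : set (borel x0)) (f : borel x0 -> R) /\
  exists M : R, forall y, A y -> `|f y| <= M.

Definition regular_for (U : set X)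
    (w : X -> {measure set (borel x0) -> \bar R}) :=
  forall (zeta : X) (f : X -> R), frontier U zeta ->
    bounded_borel (frontier U) f ->
    f @ within (frontier U) (nbhs zeta) --> f zeta ->
    (fun x => \int[w x]_(y in frontier U) f y) @ within U (nbhs zeta)
      --> f zeta.

(* [DD] is the family of domains, [omega U] the harmonic measure on [U]. *)
Definition harmonic_framework (DD : set (set X))
    (omega : set X -> X -> {measure set (borel x0) -> \bar R}) :=
  [/\ forall U, DD U -> domain U /\ frontier U !=set0,
      forall U, DD U ->
        [/\ harmonic_measure U (omega U),
            continuous_harmonic_measure U (omega U) &
            forall x, U x -> radon (omega U x)],
      forall U, DD U -> exists V : nat -> set X,
        [/\ forall n, [/\ DD (V n), regular_for (V n) (omega (V n)) &
                          relatively_compact_in (V n) U],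
            forall n, V n `<=` V n.+1 &
            U = \bigcup_n V n] &
      forall U V, DD U -> DD V -> relatively_compact_in V U ->
        regular_for V (omega V) ->
        forall (f : X -> R) x, bounded_borel (frontier U) f -> V x ->
          \int[omega U x]_(z in frontier U) f z =
          \int[omega V x]_(y in frontier V)
            (\int[omega U y]_(z in frontier U) f z)].

Section harmonic_functions.
Variables (DD : set (set X))
  (omega : set X -> X -> {measure set (borel x0) -> \bar R}).

(* Only the values of [u] on [W] matter. *)
Definition harmonic (W : set X) (u : X -> R) :=
  {within W, continuous u} /\
  forall V x, DD V -> regular_for V (omega V) -> relatively_compact_in V W -> V x ->
    u x = \int[omega V x]_(y in frontier V) u y.

Definition H1 (D : set X) (h : X -> R) :=
  [/\ harmonic D h, forall x, D x -> 0 < h x & h x0 = 1].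

Definition extreme_H1 (D : set X) (h : X -> R) :=
  H1 D h /\
  forall (f g : X -> R) (t : R), H1 D f -> H1 D g -> 0 < t < 1 ->
    {in D, forall x, h x = t * f x + (1 - t) * g x} ->
    {in D, f =1 h} /\ {in D, g =1 h}.

(* [k x y] is a version of the Radon-Nikodym derivative
   (d omega_x^U / d omega_x0^U)(y), jointly continuous on [U * frontier U]. *)
Definition continuous_kernel (U : set X) (k : X -> X -> R) :=
  {within U `*` frontier U, continuous (fun p : X * X => k p.1 p.2)} /\
  forall x, U x -> forall A : set (borel x0), measurable A ->
    A `<=` frontier U ->
    omega U x A = (\int[omega U x0]_(y in A) (k x y)%:E)%E.

End harmonic_functions.

Unset Implicit Arguments.

Section compact_product.
Variables (DD : set (set X))
  (omega : set X -> X -> {measure set (borel x0) -> \bar R})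
  (D : nat -> set X) (K : nat -> X -> X -> R).

(* The exhaustion is indexed from 0, its first term being [D 0]; all the
   relations between indices below are invariant under this shift. *)
Definition L (m : nat) : set X := closure (D m).

(* The extrema below are taken over continuous functions on compact sets. *)
Definition kmin (m : nat) : R :=
  inf [set K m.+1 p.1 p.2 | p in L m `*` frontier (D m.+1)].

Definition kmax (m : nat) : R :=
  sup [set K m.+1 p.1 p.2 | p in L m `*` frontier (D m.+1)].

Definition kosc (m : nat) (s t : X) : R :=
  sup [set `|K m.+1 s z - K m.+1 t z| | z in frontier (D m.+1)].

(* All functions on [L m] with the uniform topology, of which C(L_m) is the
   subspace of continuous functions. *)
Definition CL (m : nat) := {uniform (L m) -> R}.

Definition Q (m : nat) : set (CL m) :=
  [set g : CL m | let u := valL_ 0 (g : L m -> R) in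
    [/\ continuous (g : L m -> R),
        harmonic DD omega (D m) u,
        u x0 = 1 &
        forall i s t, (i <= m)%N -> L i s -> L i t ->
          kmin i <= u s <= kmax i /\ `|u s - u t| <= kosc i s t]].

Definition CP := prod_topology CL.

Definition P : set CP := [set p : CP | forall m, Q m (p m)].

Definition restr (m : nat) (u : X -> R) : CL m := sigL (L m) u.

Definition restrP (u : X -> R) : CP := fun m => restr m u.

Definition T_ (n m : nat) (y : X) : CL m := restr m (K n ^~ y).

Definition TP (n : nat) (y : X) : CP :=
  fun m => if (m.+2 <= n)%N then T_ n m y else (fun=> 1) : CL m.

(* The measure [h d omega_x0] on [frontier (D n)]. Since it only sees
   [frontier (D n)], where [T_ n m] and [TP n] are continuous, their values
   elsewhere are irrelevant to the push-forwards. *)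
Definition nu (h : X -> R) (n : nat) (A : set (borel x0)) : \bar R :=
  (\int[omega (D n) x0]_(y in frontier (D n) `&` A) (h y)%:E)%E.

Definition rho_ (h : X -> R) (n m : nat) : set (borel (restr m h)) -> \bar R :=
  pushforward (nu h n) (T_ n m : borel x0 -> borel (restr m h)).

Definition rho (h : X -> R) (n : nat) : set (borel (restrP h)) -> \bar R :=
  pushforward (nu h n) (TP n : borel x0 -> borel (restrP h)).

End compact_product.
End harmonic_measures.

(* Main.v *)
Require Import Defs.
From HB Require Import structures.
From mathcomp Require Import all_boot all_order all_algebra.
From mathcomp Require Import all_classical all_reals all_analysis.
From mathcomp Require Import measurable_realfun ring lra.

Set Implicit Arguments.
Unset Strict Implicit.
Unset Printing Implicit Defensive.

Import Order.TTheory GRing.Theory Num.Theory.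
Import numFieldNormedType.Exports.

Local Open Scope classical_set_scope.
Local Open Scope ring_scope.

(** Write w_n(A) for the function x |-> integral over A of h d(omega_x^{D_n})
    (below: [harmonic_part n A]).  It is harmonic on D_n, lies between 0 and h,
    and its value at x0 is nu_n(A).

    The heart of the proof is that, for any Borel sets A_n and any s in D,
    w_n(A_n)(s) - nu_n(A_n) h(s) tends to 0 ([harmonic_part_cvg]).  Indeed the
    Harnack-type bounds by kmin, kmax and kosc make the functions w_n(A_n)
    locally equicontinuous, so along any ultrafilter finer than the filter of
    cofinite sets they converge locally uniformly to a harmonic function w on
    D with 0 <= w <= h.  As h is extreme, hence minimal, w = w(x0) h
    ([extreme_minimal]), and the difference above vanishes in the limit.

    Apply this to the sets A_n of those y with K_n(s,y) >= h(s) + d.  Since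
    d(omega_s) = K_n(s,.) d(omega_x0), one has
    w_n(A_n)(s) >= (h(s) + d) nu_n(A_n), so nu_n(A_n) tends to 0; the sets
    where K_n(s,y) <= h(s) - d are treated in the same way.  Thus
    K_n(s,.) -> h(s) in nu_n-probability for each s
    ([kernel_cvg_in_probability]).  Equicontinuity on the compact set L_m
    makes this uniform in s, which is convergence in probability of T_{n,m} to
    h restricted to L_m ([T_cvg_in_probability]); convergence in the product P
    is convergence of each coordinate ([TP_cvg_in_probability]).

    Finally, convergence in probability to a point, of variables with values
    in a compact set, is weak convergence of the image laws to the Dirac mass
    at this point ([pushforward_integral_cvg]).  Compactness of Q_m and P is
    what bounds the test functions.

    The kernels are given by a relation between measures, that is, almost
    everywhere; since omega_x0 charges every neighbourhood of every point of
    the frontier, averages over small neighbourhoods of y show that, for every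
    y, K_n(., y) is nonnegative, harmonic and 1 at x0
    ([kernel_near_average]). *)

(** * Jointly continuous kernels *)

Section kernels.
Context {X Y : topologicalType} {R : realType}.
Implicit Types (A : set X) (B : set Y) (k : X -> Y -> R).

Lemma within_setX_nearP A B k :
  {within A `*` B, continuous (fun p : X * Y => k p.1 p.2)} <->
  forall x y, A x -> B y -> forall e : R, 0 < e ->
    \forall x' \near within A (nbhs x) & y' \near within B (nbhs y),
      `|k x y - k x' y'| < e.
Proof.
split.
  move=> /subspace_continuousP kc x y Ax By e e0.
  have /cvgrPdist_lt/(_ e e0) := kc (x, y) (conj Ax By).
  move=> [[U V]/= [Ux Vy] UVk].
  exists (A `&` U, B `&` V) => /=.
    by split; rewrite /within/=; [move: Ux|move: Vy];
      apply: filterS => ? ? ?; split.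
  by move=> [x' y'] /= [[Ax' Ux'] [By' Vy']]; apply: (UVk (x', y')).
move=> kn; apply/subspace_continuousP => -[x y] [/= Ax By].
apply/cvgrPdist_lt => e e0.
have [[U V]/= [Ux Vy] UVk] := kn x y Ax By e e0.
exists ([set x' | A x' -> U x'], [set y' | B y' -> V y']) => //=.
by move=> [x' y']/= [AU BV] [/= Ax' By']; apply: (UVk (x', y')); split; auto.
Qed.

Lemma within_setX_swap A B k :
  {within A `*` B, continuous (fun p : X * Y => k p.1 p.2)} ->
  {within B `*` A, continuous (fun p : Y * X => k p.2 p.1)}.
Proof.
move=> /within_setX_nearP kn; apply/subspace_continuousP => -[y x] [/= By Ax].
apply/cvgrPdist_lt => e e0.
have [[U V]/= [Ux Vy] UVk] := kn x y Ax By e e0.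
exists ([set y' | B y' -> V y'], [set x' | A x' -> U x']) => //=.
by move=> [y' x']/= [AU BV] [/= Ax' By']; apply: (UVk (x', y')); split; auto.
Qed.

Lemma within_setX_slice A B k x : A x ->
  {within A `*` B, continuous (fun p : X * Y => k p.1 p.2)} ->
  {within B, continuous (k x)}.
Proof.
move=> Ax /within_setX_nearP kn; apply/subspace_continuousP => y By.
apply/cvgrPdist_lt => e e0.
have [[U V]/= [Ux Vy] UVk] := kn x y Ax By e e0.
apply: filterS Vy => y' Vy'.
exact: (UVk (x, y') (conj (nbhs_singleton Ux Ax) Vy')).
Qed.

(** The tube lemma.  Read in one variable it says that y |-> k(., y) is
    continuous for the uniform norm on C; read in the other one (after
    [within_setX_swap]), that the functions k(., y) are equicontinuous. *)
Lemma compact_slices_equicontinuous A B C k y : compact C -> C `<=` A -> B y ->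
  {within A `*` B, continuous (fun p : X * Y => k p.1 p.2)} ->
  forall e : R, 0 < e -> \forall y' \near within B (nbhs y),
    forall x, C x -> `|k x y - k x y'| < e.
Proof.
move=> cC CA By /within_setX_nearP kn e e0.
have /compact_near_coveringP/near_covering_withinP cov := cC.
apply: (cov _ (within B (nbhs y)) (fun y' x => `|k x y - k x y'| < e)) => x Cx.
have e20 : 0 < e / 2 by rewrite divr_gt0.
have [[U V]/= [Ux Vy] UVk] := kn x y (CA _ Cx) By _ e20.
exists ([set x' | A x' -> U x'], V) => //=.
move=> [x' y']/= [Ux' Vy'] /CA/[dup] Ax' /Ux' {}Ux'.
have Vyy : V y by exact: (nbhs_singleton Vy).
have := UVk (x', y) (conj Ux' Vyy); have := UVk (x', y') (conj Ux' Vy').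
rewrite /= !ltr_norml; lra.
Qed.

End kernels.

(** * Borel sets and densities *)

Section borel_sets.
Context {T : topologicalType} {t0 : T}.

Lemma borel_open (A : set T) : open A -> measurable (A : set (borel t0)).
Proof. by move=> oA; exact: sub_sigma_algebra. Qed.

Lemma borel_closed (A : set T) : closed A -> measurable (A : set (borel t0)).
Proof.
by move=> /closed_openC/borel_open/measurableC; rewrite setCK.
Qed.

Lemma borel_within_open (E U : set T) : closed E ->
  open (U : set (subspace E)) -> measurable (E `&` U : set (borel t0)).
Proof.
move=> cE /open_subspaceP[V oV VU]; rewrite setIC -VU.
by apply: measurableI; [exact: borel_open|exact: borel_closed].
Qed.

Lemma within_continuous_measurable (R : realType) (E : set T) (f : T -> R) :
  closed E -> {within E, continuous f} ->
  measurable_fun (E : set (borel t0)) (f : borel t0 -> R).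
Proof.
move=> cE /continuousP cf; apply: (measurability _ (RGenOpens.measurableE R)).
move=> _ [_ [a [b ->] <-]]; apply: borel_within_open => //.
exact/cf/interval_open.
Qed.

Lemma within_continuous_borel (Z : topologicalType) (z0 : Z) (E : set T)
    (f : T -> Z) :
  closed E -> {within E, continuous f} ->
  measurable_fun (E : set (borel t0)) (f : borel t0 -> borel z0).
Proof.
move=> cE /continuousP cf.
apply: (@measurability _ _ (borel t0) (borel z0) E f (borel_sets z0)) => //.
by move=> _ [B oB <-]; apply: borel_within_open => //; exact: cf.
Qed.

End borel_sets.

Section density.
Context d (T : measurableType d) (R : realType).
Local Open Scope ereal_scope.
Variables (mu nu : {measure set T -> \bar R}) (E : set T) (k : T -> R).
Hypothesis mE : measurable E.
Hypothesis mk : measurable_fun E k.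
Hypothesis k0 : forall x, E x -> (0 <= k x)%R.
Hypothesis nuE : forall A, measurable A -> A `<=` E ->
  nu A = \int[mu]_(x in A) (k x)%:E.

Import HBNNSimple.

Let integral_density_nnsfun (g : {nnsfun T >-> R}) :
  \int[nu]_(x in E) (g x)%:E = \int[mu]_(x in E) ((g x)%:E * (k x)%:E).
Proof.
have mEk : measurable_fun E (EFin \o k) by exact/measurable_EFinP.
have gE x : (g x)%:E = \sum_(r \in range g) (r * \1_(g @^-1` [set r]) x)%:E.
  by rewrite fsumEFin// -fimfunE.
have gr0 r t : 0 <= (r * \1_(g @^-1` [set r]) t)%:E.
  exact: nnfun_muleindic_ge0.
have mgr r : measurable_fun E (fun t => (r * \1_(g @^-1` [set r]) t)%:E).
  by apply/measurable_EFinP; apply: measurable_funM.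
under eq_integral do rewrite gE.
rewrite ge0_integral_fsum//.
under [RHS]eq_integral => x xE.
  rewrite gE ge0_mule_fsuml//; over.
rewrite ge0_integral_fsum//; last 2 first.
- by move=> r; exact: emeasurable_funM.
- by move=> r x Ex; rewrite mule_ge0// lee_fin k0.
apply: eq_fsbigr => r rg.
rewrite (integralZl_indic_nnsfun _ mE).
under [RHS]eq_integral do rewrite EFinM -muleA.
rewrite ge0_integralZl//; last 3 first.
- by apply: emeasurable_funM => //; exact/measurable_EFinP.
- by move=> x Ex; rewrite mule_ge0// lee_fin// k0.
- by move: rg; rewrite inE => -[t _ <-]; rewrite lee_fin.
congr (_ * _); rewrite integral_indic// nuE//; last exact: measurableI.
rewrite setIC integral_mkcondr; apply: eq_integral => x xE.
by rewrite epatch_indic /= muleC.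
Qed.

(** The formula holds for indicators by assumption, hence for simple functions
    by linearity, hence for all nonnegative functions by monotone
    convergence. *)
Lemma ge0_integral_density (f : T -> R) :
  measurable_fun E f -> (forall x, E x -> (0 <= f x)%R) ->
  \int[nu]_(x in E) (f x)%:E = \int[mu]_(x in E) (f x * k x)%:E.
Proof.
move=> mf f0.
have mEf : measurable_fun E (EFin \o f) by exact/measurable_EFinP.
have mEk : measurable_fun E (EFin \o k) by exact/measurable_EFinP.
pose h := nnsfun_approx mE mEf.
have cvgh x : E x -> (h n x)%:E @[n --> \oo] --> (f x)%:E.
  by move=> Ex; apply: cvg_nnsfun_approx => // y Ey; rewrite lee_fin f0.
have hle a b x : (a <= b)%N -> (h a x <= h b x)%R.
  by move=> ab; exact/lefP/nd_nnsfun_approx.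
transitivity (limn (fun n => \int[nu]_(x in E) (h n x)%:E)).
  rewrite -monotone_convergence//.
  - apply: eq_integral => x /[!inE] Ex.
    by apply/esym/cvg_lim => //; exact: cvgh.
  - by move=> n; apply/measurable_EFinP/measurable_funTS.
  - by move=> n x _; rewrite lee_fin.
  - by move=> x _ a b /hle hab; rewrite lee_fin.
under eq_fun do rewrite integral_density_nnsfun.
rewrite -monotone_convergence//.
- apply: eq_integral => x /[!inE] Ex; rewrite EFinM; apply/cvg_lim => //.
  by apply: cvgeZr => //; exact: cvgh.
- move=> n; apply: emeasurable_funM => //.
  by apply/measurable_EFinP/measurable_funTS.
- by move=> n x Ex; rewrite mule_ge0 ?lee_fin ?k0.
- by move=> x Ex a b /hle hab; rewrite lee_wpmul2r ?lee_fin ?k0.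
Qed.

End density.

(** * Bounded functions on frontiers *)

Section Rintegral_bounds.
Context d (T : measurableType d) (R : realType).
Variables (mu : {measure set T -> \bar R}) (E : set T).
Hypotheses (mE : measurable E) (muE : (mu E < +oo)%E).

Lemma Rintegral_dist_le (f g : T -> R) (e : R) :
  mu.-integrable E (EFin \o f) -> mu.-integrable E (EFin \o g) ->
  (forall x, E x -> `|f x - g x| <= e) ->
  `|\int[mu]_(x in E) f x - \int[mu]_(x in E) g x| <= e * fine (mu E).
Proof.
move=> fi gi fge; rewrite -RintegralB//.
have fgi : mu.-integrable E (EFin \o (f \- g)).
  by apply: eq_integrable (integrableB mE fi gi) => //.
apply: le_trans (le_normr_Rintegral mE fgi) _.
rewrite -Rintegral_cst//; apply: le_Rintegral => //.
- exact: integrable_norm.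
- apply: measurable_bounded_integrable => //.
  by exists `|e|; split; [exact: num_real|move=> N eN y _; exact: ltW].
Qed.

End Rintegral_bounds.

Section frontier.
Context {T : topologicalType}.
Implicit Types U V W : set T.

Lemma frontier_closed U : closed (frontier U).
Proof.
rewrite /frontier setDE; apply: closedI; first exact: closed_closure.
exact/open_closedC/open_interior.
Qed.

Lemma frontier_closure U : frontier U `<=` closure U.
Proof. by move=> y []. Qed.

Lemma frontier_compact U : compact (closure U) -> compact (frontier U).
Proof.
by move=> cU; apply: subclosed_compact cU _;
  [exact: frontier_closed|exact: frontier_closure].
Qed.

Lemma relatively_compact_frontier V W :
  relatively_compact_in V W -> frontier V `<=` W.
Proof. by move=> [_ VW] y /frontier_closure/VW. Qed.

Lemma relatively_compact_sub V W : relatively_compact_in V W -> V `<=` W.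
Proof. by move=> [_ VW] y /subset_closure/VW. Qed.

End frontier.

Lemma compact_within_bounded {R : realType} {T : topologicalType}
    (E : set T) (f : T -> R) :
  compact E -> {within E, continuous f} ->
  exists2 M, 0 < M & forall y, E y -> `|f y| <= M.
Proof.
move=> cE cf; have [M [Mr MP]] := compact_bounded (continuous_compact cf cE).
exists (`|M| + 1) => [|y Ey]; first by rewrite ltr_wpDl.
by apply: (MP (`|M| + 1)); [rewrite ltr_pwDr// ler_norm|exists y].
Qed.

Section bounded_borel.
Context {R : realType} {X : metricType R} {x0 : X}.

Lemma within_continuous_bounded_borel (E : set X) (f : X -> R) :
  compact E -> {within E, continuous f} -> bounded_borel (x0 := x0) E f.
Proof.
move=> cE cf; split.
  apply: within_continuous_measurable => //.
  by apply: compact_closed => //; exact: metric_hausdorff.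
by have [M _ fM] := compact_within_bounded cE cf; exists M.
Qed.

Lemma bounded_borel_integrable (mu : {measure set (borel x0) -> \bar R})
    (E : set X) (f : X -> R) :
  measurable (E : set (borel x0)) -> (mu E < +oo)%E ->
  bounded_borel (x0 := x0) E f ->
  mu.-integrable E (EFin \o f).
Proof.
move=> mE muE [mf [M fM]]; apply: measurable_bounded_integrable => //.
exists M; split; first exact: num_real.
by move=> N MN y Ey /=; rewrite (le_trans (fM _ Ey))// ltW.
Qed.

Lemma bounded_borelM (E : set X) (f g : X -> R) :
  bounded_borel (x0 := x0) E f -> bounded_borel (x0 := x0) E g ->
  bounded_borel (x0 := x0) E (f \* g).
Proof.
move=> [mf [M fM]] [mg [N gN]]; split; first exact: measurable_funM.
by exists (M * N) => y Ey; rewrite normrM ler_pM ?fM ?gN.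
Qed.

Lemma bounded_borel_indic (E A : set X) : measurable (A : set (borel x0)) ->
  bounded_borel (x0 := x0) E (\1_A : X -> R).
Proof.
move=> mA; split.
  exact: (@measurable_indic _ (borel x0)).
exists 1 => y _; rewrite indicE; case: (_ \in _) => /=; rewrite ?normr1// normr0.
exact: ler01.
Qed.

Lemma bounded_borel_cst (E : set X) (c : R) :
  bounded_borel (x0 := x0) E (fun=> c).
Proof. by split; [exact: measurable_cst|exists `|c| => y _]. Qed.

End bounded_borel.

(** * Limits along ultrafilters *)

Section ultrafilters.

Lemma ultra_fmap (T U : Type) (f : T -> U) (F : set_system T) :
  UltraFilter F -> UltraFilter (f @ F).
Proof.
move=> UF; split; first exact: fmap_proper_filter.
move=> G PG FG; apply/seteqP; split => // A GA.
have [//|FnA] := in_ultra_setVsetC (f @^-1` A) UF.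
have GnA : G (~` A) by exact: FG.
case: (@filter_not_empty _ G PG).
by rewrite -(setICr A); exact: filterI.
Qed.

(** A filter is the intersection of the ultrafilters that refine it.  Testing
    convergence along ultrafilters replaces the extraction of convergent
    subsequences, since bounded functions converge along any of them. *)
Lemma near_ultra (T : Type) (G : set_system T) (B : set T) : Filter G ->
  (forall F, UltraFilter F -> G `<=` F -> F B) -> G B.
Proof.
move=> FG allF; apply: contrapT => GnB.
have PG : ProperFilter (within (~` B) G).
  split; last exact: within_filter.
  move=> Gw; have {}Gw : G (fun x => (~` B) x -> set0 x) := Gw.
  apply: GnB; apply: filterS Gw => x nBx.
  by apply: contrapT => /nBx.
have [F [UF GF]] := ultraFilterLemma PG.
have FB : F B.
  apply: (allF F UF) => A GA; apply: GF.
  suff : G (fun x => (~` B) x -> A x) by [].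
  by apply: filterS GA => x Ax _.
have FnB : F (~` B) by apply: GF; exact: withinT.
case: (@filter_not_empty _ F (@ultra_proper _ F UF)).
by rewrite -(setICr B); exact: filterI.
Qed.

Context {R : realType} {I : Type} {F : set_system I}.
Hypothesis UF : UltraFilter F.

Lemma ultra_bounded_cvg (f : I -> R) (M : R) :
  (\forall i \near F, `|f i| <= M) -> f i @[i --> F] --> lim (f i @[i --> F]).
Proof.
move=> fM; have UfF := ultra_fmap f UF.
have := @segment_compact R (- M) M; rewrite compact_ultra => /(_ _ UfF)[].
  by apply: filterS fM => i /=; rewrite in_itv/= ler_norml.
by move=> l [_ fl]; exact: (cvgP l fl).
Qed.

Lemma ultra_lim_dist (f g : I -> R) (M c : R) :
  (\forall i \near F, `|f i| <= M) -> (\forall i \near F, `|g i| <= M) ->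
  (\forall i \near F, `|f i - g i| <= c) ->
  `|lim (f i @[i --> F]) - lim (g i @[i --> F])| <= c.
Proof.
move=> fM gM fgc.
have fg : `|f i - g i| @[i --> F] -->
    `|lim (f i @[i --> F]) - lim (g i @[i --> F])|.
  by apply: cvg_norm; apply: cvgB; [exact: ultra_bounded_cvg fM|
    exact: ultra_bounded_cvg gM].
rewrite -(cvg_lim (@Rhausdorff R) fg); apply: limr_le => //.
exact: (cvgP _ fg).
Qed.

(** The Arzela-Ascoli argument: boundedness gives the pointwise limit, and near
    each s in C the common modulus [osc] transfers convergence at s to
    convergence at the points around s; finitely many such neighbourhoods
    cover C. *)
Lemma ultra_equicontinuous_cvg (X : topologicalType) (C : set X)
    (osc : X -> X -> R) (u : I -> X -> R) (M : R) : compact C ->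
  (forall s (e : R), C s -> 0 < e ->
    \forall t \near within C (nbhs s), osc s t <= e) ->
  (\forall i \near F, forall s, C s -> `|u i s| <= M) ->
  (\forall i \near F, forall s t, C s -> C t -> `|u i s - u i t| <= osc s t) ->
  forall e : R, 0 < e -> \forall i \near F,
    forall s, C s -> `|u i s - lim (u j s @[j --> F])| <= e.
Proof.
move=> cC oscC uM uosc e e0; set v := fun s => lim (u j s @[j --> F]).
have uv s : C s -> u j s @[j --> F] --> v s.
  by move=> Cs; apply: (@ultra_bounded_cvg _ M); apply: filterS uM => i; apply.
have vosc s t : C s -> C t -> `|v s - v t| <= osc s t.
  move=> Cs Ct; apply: (@ultra_lim_dist _ _ M);
    [move: uM|move: uM|move: uosc]; by apply: filterS => i; apply.
have /compact_near_coveringP/near_covering_withinP cov := cC.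
apply: (cov _ F (fun i s => `|u i s - v s| <= e)) => s Cs.
have e30 : 0 < e / 3 by rewrite divr_gt0.
have /cvgrPdist_le/(_ _ e30) us := uv s Cs.
exists ([set t | C t -> osc s t <= e / 3],
  [set i | `|v s - u i s| <= e / 3 /\
     forall s t, C s -> C t -> `|u i s - u i t| <= osc s t]) => /=.
  by split; [exact: oscC|apply: filterI].
move=> [t i]/= [oscst [vui ui]] Ct.
have := vosc s t Cs Ct; have := ui s t Cs Ct; have := oscst Ct; move: vui.
rewrite !ler_norml; lra.
Qed.

End ultrafilters.

(** * Uniform and product topologies *)

Section uniform_nbhs.
Context {R : realType} {T : choiceType}.
Implicit Types f g : {uniform T -> R}.

Lemma uniform_nbhsP f (P : set {uniform T -> R}) : nbhs f P <->
  exists2 e : R, 0 < e & [set g | forall s, `|f s - g s| <= e] `<=` P.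
Proof.
rewrite uniform_nbhs; split => [[E [entE EP]]|[e e0 eP]].
  move: entE; rewrite -entourage_ballE => -[e /= e0 eE].
  exists (e / 2); first by rewrite divr_gt0.
  move=> g fg; apply: EP => s _; apply: eE => /=.
  by rewrite /ball/=; apply: le_lt_trans (fg s) _; rewrite ltr_pdivrMr//; lra.
exists [set xy | ball xy.1 e xy.2]; split.
  by rewrite -entourage_ballE; exists e.
by move=> g fg; apply: eP => s; exact/ltW/fg.
Qed.

Lemma uniform_hausdorff : hausdorff_space {uniform T -> R}.
Proof.
move=> f g clfg; apply/funext => s; apply/eqP; rewrite -subr_eq0 -normr_eq0.
apply/eqP/le_anti; rewrite normr_ge0 andbT; apply/ler_addgt0Pl => e e0.
have e20 : 0 < e / 2 by rewrite divr_gt0.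
have nb (p : {uniform T -> R}) :
    nbhs p [set q : {uniform T -> R} | forall s, `|p s - q s| <= e / 2].
  by apply/uniform_nbhsP; exists (e / 2).
have [q [/= /(_ s) fq /(_ s) gq]] := clfg _ _ (nb f) (nb g).
by rewrite addr0; move: fq gq; rewrite !ler_norml; lra.
Qed.

End uniform_nbhs.

Lemma cvg_product (I J : Type) (T : I -> topologicalType) (G : set_system J)
    (f : J -> prod_topology T) (p : prod_topology T) : Filter G ->
  (forall i, f j i @[j --> G] --> p i) -> f j @[j --> G] --> p.
Proof.
move=> FG fp; apply/cvg_sup => i A /= [_ [[B oB <-] Bp BA]].
have GB : G (fun j => B (f j i)) by apply: (fp i); exact: open_nbhs_nbhs.
suff : G (fun j => A (f j)) by [].
by apply: filterS GB => j fB; exact: BA.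
Qed.

(** * Image measures and concentration *)

Section weighted_image.
Context d d' (T1 : measurableType d) (T2 : measurableType d') (R : realType).
Variables (mu : {measure set T1 -> \bar R}) (phi : T1 -> T2) (g : T1 -> R).

(** The image under phi of the measure with density g.  The side conditions
    are arguments so that the measure structure can be attached to the
    term. *)
Definition weighted_image (mphi : measurable_fun setT phi)
    (mg : measurable_fun setT g) (g0 : forall x, 0 <= g x)
    (B : set T2) : \bar R :=
  (\int[mu]_(x in phi @^-1` B) (g x)%:E)%E.

Hypotheses (mphi : measurable_fun setT phi) (mg : measurable_fun setT g)
  (g0 : forall x, 0 <= g x).
Local Notation w := (weighted_image mphi mg g0).

Let mpre B : measurable B -> measurable (phi @^-1` B).
Proof. by move=> mB; rewrite -[X in measurable X]setTI; exact: mphi. Qed.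

Let w0 : w set0 = 0%E.
Proof. by rewrite /weighted_image preimage_set0 integral_set0. Qed.

Let w_ge0 B : (0 <= w B)%E.
Proof. by apply: integral_ge0 => x _; rewrite lee_fin. Qed.

Let w_additive : semi_sigma_additive w.
Proof.
move=> B mB tB mUB; rewrite /weighted_image preimage_bigcup.
rewrite ge0_integral_bigcup//.
- by apply: is_cvg_ereal_nneg_natsum_cond => n _ _; exact: w_ge0.
- by move=> n; exact: mpre.
- by apply/measurable_EFinP; exact: measurable_funTS.
- by move=> x _; rewrite lee_fin.
- apply/trivIsetP => i j _ _ ij; rewrite -preimage_setI.
  by move/trivIsetP : tB => /(_ _ _ _ _ ij) ->//; rewrite preimage_set0.
Qed.

HB.instance Definition _ := isMeasure.Build _ _ _ w w0 w_ge0 w_additive.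

End weighted_image.

Section raw_integral.
Context d (T : measurableType d) (R : realType).

Import HBNNSimple.

(** The integral is defined for any set function, and only looks at its values
    on measurable sets.  This reaches images under maps that are measurable
    only where the measure lives, which need not be measures as they
    stand. *)
Lemma eq_integral_measurable (mu1 mu2 : set T -> \bar R) (D : set T)
    (f : T -> \bar R) : (forall A, measurable A -> mu1 A = mu2 A) ->
  (\int[mu1]_(x in D) f x = \int[mu2]_(x in D) f x)%E.
Proof.
move=> mu12.
have eqs (g : {nnsfun T >-> R}) : sintegral mu1 g = sintegral mu2 g.
  by apply: eq_fsbigr => r _; rewrite mu12.
rewrite /integral; congr (ereal_sup _ - ereal_sup _)%E;
  by apply/seteqP; split => _ [g gf <-]; exists g.
Qed.

Lemma Rintegral_concentrated (mu : {measure set T -> \bar R}) (S B : set T)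
    (f : T -> R) (c e M : R) : measurable S -> measurable B -> mu S = 1%E ->
  measurable_fun S f -> 0 <= M -> 0 <= e ->
  (forall x, S x -> `|f x - c| <= M) ->
  (forall x, S x -> ~ B x -> `|f x - c| <= e) ->
  `|\int[mu]_(x in S) f x - c| <= e + M * fine (mu (S `&` B)).
Proof.
move=> mS mB muS mf M0 e0 fM fe.
have muSoo : (mu S < +oo)%E by rewrite muS ltry.
have bint (g : T -> R) (N : R) : measurable_fun S g ->
    (forall x, S x -> `|g x| <= N) ->
    mu.-integrable S (EFin \o g).
  move=> mg gN; apply: measurable_bounded_integrable => //.
  exists N; split; first exact: num_real.
  by move=> N' NN' y Sy /=; rewrite (le_trans (gN _ Sy))// ltW.
have fi : mu.-integrable S (EFin \o f).
  apply: (bint _ (M + `|c|)) => // x Sx.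
  by rewrite -[f x](subrK c) (le_trans (ler_normD _ _))// lerD// fM.
have ci : mu.-integrable S (EFin \o (fun=> c)).
  by apply: (bint _ `|c|).
have mI : measurable_fun S (fun x => e + M * \1_B x).
  by apply: measurable_funD => //; apply: measurable_funM => //;
    exact: measurable_indic.
have Ii : mu.-integrable S (EFin \o (fun x => e + M * \1_B x)).
  apply: (bint _ (e + M)) => // x _.
  rewrite indicE ger0_norm ?addr_ge0 ?mulr_ge0//.
  by rewrite lerD2l ler_piMr//; case: (_ \in _).
have {1}-> : c = \int[mu]_(x in S) c by rewrite Rintegral_cst// muS mulr1.
rewrite -RintegralB//.
have di : mu.-integrable S (EFin \o (f \- (fun=> c))).
  by apply: eq_integrable (integrableB mS fi ci).
apply: le_trans (le_normr_Rintegral mS di) _.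
apply: (@le_trans _ _ (\int[mu]_(x in S) (e + M * \1_B x))).
  apply: le_Rintegral => //; first exact: integrable_norm.
  move=> x Sx /=; rewrite indicE; have [/set_mem Bx|nBx] := boolP (x \in B).
    by rewrite mulr1 (le_trans (fM x Sx))// lerDr.
  by rewrite mulr0 addr0 fe// => Bx; rewrite mem_set in nBx.
have i1 : mu.-integrable S (EFin \o (\1_B : T -> R)).
  apply: (bint _ 1); first exact: measurable_indic.
  by move=> x _; rewrite indicE; case: (_ \in _); rewrite /= ?normr1// normr0.
have eint : mu.-integrable S (EFin \o (fun=> e)).
  by apply: (bint _ `|e|).
rewrite RintegralD//; last exact: (integrableZl mS M i1).
rewrite Rintegral_cst// muS mulr1 RintegralZl// lerD2l.
by rewrite /Rintegral integral_indic// setIC.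
Qed.

End raw_integral.

(** * Harmonic measure of a regular domain *)

Section framework.
Context {R : realType} {X : metricType R} {x0 : X} {DD : set (set X)}
  {omega : set X -> X -> {measure set (borel x0) -> \bar R}}.
Hypothesis hframe : harmonic_framework DD omega.

Section domain_measure.
Variable U : set X.
Hypothesis DU : DD U.

Lemma DD_open : open U.
Proof. by case: hframe => /(_ _ DU)[[]]. Qed.

Lemma measurable_frontier : measurable (frontier U : set (borel x0)).
Proof. by apply: borel_closed; exact: frontier_closed. Qed.

Lemma omega_frontier x : U x -> omega U x (frontier U) = 1%E.
Proof. by move=> Ux; case: hframe => _ /(_ _ DU)[[/(_ x Ux)[]]]. Qed.

Lemma omega_frontierC x : U x -> omega U x (~` frontier U) = 0%E.
Proof. by move=> Ux; case: hframe => _ /(_ _ DU)[[/(_ x Ux)[]]]. Qed.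

Lemma omega_lty x (A : set X) : U x -> measurable (A : set (borel x0)) ->
  A `<=` frontier U -> (omega U x A < +oo)%E.
Proof.
move=> Ux mA AU.
apply: (@le_lt_trans _ _ (omega U x (frontier U))); last first.
  by rewrite omega_frontier ?ltry.
by apply: le_measure; rewrite ?inE//; exact: measurable_frontier.
Qed.

Lemma omega_integrable x (A : set X) (f : X -> R) : U x ->
  measurable (A : set (borel x0)) -> A `<=` frontier U ->
  bounded_borel (x0 := x0) (frontier U) f ->
  (omega U x).-integrable A (EFin \o f).
Proof.
move=> Ux mA AU bf.
have mF := measurable_frontier.
have fi : (omega U x).-integrable (frontier U) (EFin \o f).
  by apply: bounded_borel_integrable => //; rewrite omega_frontier// ltry.
exact: (integrableS mF mA AU fi).
Qed.

Lemma Rintegral_omega_cst x (c : R) : U x ->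
  \int[omega U x]_(y in frontier U) c = c.
Proof.
move=> Ux; rewrite Rintegral_cst; last exact: measurable_frontier.
by rewrite omega_frontier// mulr1.
Qed.

Lemma Rintegral_omega_indic x (A : set X) :
  measurable (A : set (borel x0)) -> A `<=` frontier U ->
  \int[omega U x]_(y in frontier U) (\1_A y) = fine (omega U x A).
Proof.
move=> mA AU.
rewrite /Rintegral integral_indic//; last exact: measurable_frontier.
by congr (fine (omega U x _)); apply/setIidPl.
Qed.

(** If B were null for one point of U, then it would be null for all of them by
    mutual absolute continuity, so the harmonic function with boundary values
    1_B would vanish; but it tends to 1 at y by regularity. *)
Lemma omega_full_support (hU : regular_for U (omega U)) x y (B : set X) :
  U x -> frontier U y -> open B -> B y -> (0 < omega U x B)%E.
Proof.
move=> Ux Fy oB By; rewrite lt0e measure_ge0 andbT; apply/eqP => wB0.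
have mB : measurable (B : set (borel x0)) by exact: borel_open.
have wB z : U z -> omega U z (B `&` frontier U) = 0%E.
  move=> Uz; have : omega U z B = 0%E.
    case: hframe => _ /(_ _ DU)[[_ ac] _ _] _ _.
    have /null_content_dominatesP := ac z x Uz Ux.
    by move=> /(_ B mB) ->.
  move=> wzB; apply/eqP; rewrite -measure_le0 -wzB le_measure ?inE//.
  by apply: measurableI => //; exact: measurable_frontier.
have fB : \1_B y = 1 :> R by rewrite indicE mem_set.
have fcvg : (\1_B : X -> R) @ within (frontier U) (nbhs y) --> (\1_B y : R).
  rewrite fB; apply: cvg_near_cst; apply: cvg_within.
  have : nbhs y B by exact: open_nbhs_nbhs.
  by apply: filterS => z Bz; rewrite indicE mem_set.
have := hU _ _ Fy (bounded_borel_indic _ mB) fcvg; rewrite fB => lim1.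
have PF : ProperFilter (within U (nbhs y)).
  by apply: within_nbhs_proper; case: Fy.
have : (fun x => \int[omega U x]_(z in frontier U) (\1_B z : R))
    @ within U (nbhs y) --> (0 : R).
  apply: cvg_near_cst; apply: filterS (withinT _ _) => z Uz.
  by rewrite /Rintegral integral_indic ?wB//; exact: measurable_frontier.
by move=> /(cvg_unique (@Rhausdorff R) lim1)/eqP; rewrite oner_eq0.
Qed.

End domain_measure.

End framework.

Section relative_kernel.
Context {R : realType} {X : metricType R} {x0 : X} {DD : set (set X)}
  {omega : set X -> X -> {measure set (borel x0) -> \bar R}}.
Hypothesis hframe : harmonic_framework DD omega.
Variables (U : set X) (k : X -> X -> R).
Hypotheses (DU : DD U) (regU : regular_for U (omega U))
  (cU : compact (closure U)) (Ux0 : U x0) (hk : continuous_kernel omega U k).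

Let mF : measurable (frontier U : set (borel x0)) := measurable_frontier U.
Let cF : compact (frontier U) := frontier_compact cU.

Lemma kernel_bounded_borel x : U x ->
  bounded_borel (x0 := x0) (frontier U) (k x).
Proof.
move=> Ux; apply: within_continuous_bounded_borel => //.
by case: hk => /(within_setX_slice Ux).
Qed.

(** Averaging d(omega_x) = k(x,.) d(omega_x0) over a small piece A of the
    frontier around y recovers k(x,y), uniformly for x in C, and A has
    positive measure by full support.  A relation between the measures
    omega_x thus becomes a relation between the values k(x,y) at every y,
    not just at almost every y. *)
Lemma kernel_near_average (C : set X) y (e : R) : compact C -> C `<=` U ->
  frontier U y -> 0 < e ->
  exists A : set X, [/\ measurable (A : set (borel x0)), A `<=` frontier U,
    0 < fine (omega U x0 A) &
    forall x, C x -> `|fine (omega U x A) - k x y * fine (omega U x0 A)|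
      <= e * fine (omega U x0 A)].
Proof.
move=> cC CU Fy e0; case: hk => kc kE.
have := compact_slices_equicontinuous cC CU Fy kc e0.
rewrite {1}/within /= nbhsE => -[B [oB By] BP].
have mB : measurable (B : set (borel x0)) by exact: borel_open.
pose A := B `&` frontier U.
have mA : measurable (A : set (borel x0)) by exact: measurableI.
have AF : A `<=` frontier U by move=> z [].
have wA : (omega U x0 A < +oo)%E by exact: (omega_lty hframe DU Ux0 mA AF).
exists A; split => //.
  apply: fine_gt0; rewrite wA andbT.
  suff -> : omega U x0 A = omega U x0 B.
    exact: (omega_full_support hframe DU regU Ux0 Fy).
  have BE : B = A `|` (B `&` ~` frontier U).
    by rewrite /A -setIUr setUCr setIT.
  rewrite [in RHS]BE measureU//; last 2 first.
  - by apply: measurableI => //; exact: measurableC.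
  - by apply/seteqP; split => // z [[_ Fz] [_ nFz]].
  rewrite [X in _ = (_ + X)%E](_ : _ = 0%E) ?adde0//.
  apply/eqP; rewrite -measure_le0 -(omega_frontierC hframe DU Ux0).
  apply: le_measure => [||z []//]; rewrite inE; last exact: measurableC.
  by apply: measurableI => //; exact: measurableC.
move=> x Cx; have Ux := CU _ Cx.
have -> : fine (omega U x A) = \int[omega U x0]_(z in A) k x z.
  by rewrite (kE x Ux A mA AF).
have -> : k x y * fine (omega U x0 A) = \int[omega U x0]_(z in A) k x y.
  by rewrite Rintegral_cst.
apply: le_trans (Rintegral_dist_le mA wA _ _ _) _; last exact: lexx.
- exact: (omega_integrable hframe DU Ux0 mA AF (kernel_bounded_borel Ux)).
- exact: (omega_integrable hframe DU Ux0 mA AF (bounded_borel_cst _ _)).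
- by move=> z [Bz Fz]; rewrite distrC ltW//; apply: BP.
Qed.

Lemma kernel_ge0 x y : U x -> frontier U y -> 0 <= k x y.
Proof.
move=> Ux Fy; rewrite leNgt; apply/negP => kxy0.
have k20 : 0 < - k x y / 2 by rewrite divr_gt0// oppr_gt0.
have xU : [set x] `<=` U by move=> z ->.
have [A [mA AF a0 /(_ x erefl)]] :=
  kernel_near_average (@compact_set1 _ x) xU Fy k20.
have : 0 <= fine (omega U x A) by exact: fine_ge0.
rewrite ler_norml; nra.
Qed.

Lemma kernel_normalized y : frontier U y -> k x0 y = 1.
Proof.
move=> Fy; apply/eqP; rewrite eq_sym -subr_eq0 -normr_eq0 -[_ == _]negbK.
apply/negP => n1; have {n1} : 0 < `|1 - k x0 y| by rewrite lt0r n1 /=.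
set e := `|1 - k x0 y| => e0.
have e20 : 0 < e / 2 by rewrite divr_gt0.
have xU : [set x0] `<=` U by move=> z ->.
have [A [mA AF a0 /(_ x0 erefl)]] :=
  kernel_near_average (@compact_set1 _ x0) xU Fy e20.
rewrite -[X in X - _]mul1r -mulrBl normrM -/e (gtr0_norm a0); nra.
Qed.

Lemma kernel_density x (f : X -> R) : U x ->
  bounded_borel (x0 := x0) (frontier U) f ->
  (forall y, frontier U y -> 0 <= f y) ->
  \int[omega U x]_(y in frontier U) f y =
  \int[omega U x0]_(y in frontier U) (f y * k x y).
Proof.
move=> Ux [mf _] f0; rewrite /Rintegral; congr fine.
apply: (@ge0_integral_density _ (borel x0)) => //.
- by case: (kernel_bounded_borel Ux).
- by move=> y Fy; exact: kernel_ge0.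
- by move=> A mA AF; case: hk => _; apply.
Qed.

Lemma kernel_equicontinuous x (e : R) : U x -> 0 < e ->
  \forall x' \near within U (nbhs x),
    forall y, frontier U y -> `|k x y - k x' y| < e.
Proof.
move=> Ux e0; case: hk => kc _.
exact: (@compact_slices_equicontinuous X X R (frontier U) U (frontier U)
  (fun y x => k x y) x cF (fun y Fy => Fy) Ux (within_setX_swap kc) e e0).
Qed.

End relative_kernel.

(** * Harmonic functions *)

Section harmonic_functions.
Context {R : realType} {X : metricType R} {x0 : X} {DD : set (set X)}
  {omega : set X -> X -> {measure set (borel x0) -> \bar R}}.
Hypothesis hframe : harmonic_framework DD omega.
Implicit Types (U V W : set X) (u v : X -> R).
Local Notation harmonic := (Defs.harmonic DD omega).
Local Notation bounded_borel := (bounded_borel (x0 := x0)).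

Lemma relatively_compact_bounded_borel V W u : relatively_compact_in V W ->
  {within W, continuous u} -> bounded_borel (frontier V) u.
Proof.
move=> VW cu; apply: within_continuous_bounded_borel.
  by apply: frontier_compact; case: VW.
exact: continuous_subspaceW (relatively_compact_frontier VW) cu.
Qed.

Lemma eq_harmonic W u v : (forall x, W x -> u x = v x) ->
  harmonic W u -> harmonic W v.
Proof.
move=> uv [cu mu]; split.
  by apply: subspace_eq_continuous cu => x /set_mem /uv.
move=> V x DV regV VW Vx.
rewrite -uv; last exact: (relatively_compact_sub VW Vx).
rewrite (mu V x DV regV VW Vx); apply: eq_Rintegral => y /set_mem Fy.
exact/uv/(relatively_compact_frontier VW).
Qed.

Lemma sub_harmonic W W' u : W' `<=` W -> harmonic W u -> harmonic W' u.
Proof.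
move=> W'W [cu mu]; split; first exact: continuous_subspaceW cu.
move=> V x DV regV [cV VW'] Vx; apply: mu => //; split=> //.
exact: subset_trans W'W.
Qed.

Lemma harmonic_cst W (c : R) : harmonic W (fun=> c).
Proof.
split; first by apply: continuous_subspaceT => x; exact: cvg_cst.
by move=> V x DV regV VW Vx; rewrite (Rintegral_omega_cst hframe DV _ Vx).
Qed.

Lemma harmonic_lincomb W u v (a b : R) : harmonic W u -> harmonic W v ->
  harmonic W (fun x => a * u x + b * v x).
Proof.
move=> [cu mu] [cv mv]; split.
  move=> x; apply: cvgD; apply: cvgM; first [exact: cvg_cst|exact: cu|exact: cv].
move=> V x DV regV VW Vx.
have mF := measurable_frontier (x0 := x0) V.
have iZ w (c : R) : {within W, continuous w} ->
    (omega V x).-integrable (frontier V) (EFin \o w).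
  move=> cw; apply: (omega_integrable hframe DV Vx mF) => //.
  exact: relatively_compact_bounded_borel VW cw.
have iu := iZ u a cu; have iv := iZ v b cv.
rewrite RintegralD//; last 2 first.
- exact: (integrableZl mF a iu).
- exact: (integrableZl mF b iv).
by rewrite !RintegralZl// -mu// -mv.
Qed.

(** The mean value property over V only involves the values on the compact
    closure of V, so it passes to limits that are uniform on such closures.
    The approximating function may depend on V. *)
Lemma harmonic_approx W v : {within W, continuous v} ->
  (forall V (e : R), relatively_compact_in V W -> 0 < e ->
    exists2 u, (exists2 W', relatively_compact_in V W' & harmonic W' u) &
               forall x, closure V x -> `|u x - v x| <= e) ->
  harmonic W v.
Proof.
move=> cv app; split=> // V x DV regV VW Vx.
apply/eqP; rewrite -subr_eq0 -normr_le0; apply/ler_addgt0Pl => e e0.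
have e20 : 0 < e / 2 by rewrite divr_gt0.
have [u [W' VW' [cu mu]] uv] := app V _ VW e20.
have mF := measurable_frontier (x0 := x0) V.
have iu : (omega V x).-integrable (frontier V) (EFin \o u).
  apply: (omega_integrable hframe DV Vx mF) => //.
  exact: relatively_compact_bounded_borel VW' cu.
have iv : (omega V x).-integrable (frontier V) (EFin \o v).
  apply: (omega_integrable hframe DV Vx mF) => //.
  exact: relatively_compact_bounded_borel VW cv.
have F1 := omega_frontier hframe DV Vx.
have Foo : (omega V x (frontier V) < +oo)%E by rewrite F1 ltry.
have uvF y : frontier V y -> `|u y - v y| <= e / 2.
  by move=> /frontier_closure; exact: uv.
have := Rintegral_dist_le mF Foo iu iv uvF.
rewrite F1 mulr1 -(mu V x DV regV VW' Vx).
have := uv x (subset_closure Vx).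
by rewrite addr0 !ler_norml; lra.
Qed.

Section poisson_integrals.
Variables (U : set X) (k : X -> X -> R).
Hypotheses (DU : DD U) (regU : regular_for U (omega U))
  (cU : compact (closure U)) (Ux0 : U x0) (hk : continuous_kernel omega U k).

Definition poisson (f : X -> R) (x : X) := \int[omega U x]_(y in frontier U) f y.

(** The mean value property is the compatibility between the harmonic measures
    of U and V.  Continuity comes from the density formula and the continuity
    of x |-> k(x,.) for the uniform norm. *)
Lemma poisson_harmonic (f : X -> R) : bounded_borel (frontier U) f ->
  (forall y, frontier U y -> 0 <= f y) -> harmonic U (poisson f).
Proof.
move=> bf f0; split; last first.
  move=> V x DV regV VU Vx; case: hframe => _ _ _; apply => //.
apply/subspace_continuousP => x Ux; apply/cvgrPdist_lt => e e0.
have [_ [M fM]] := bf.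
have [M1 [M10 fM1]] : exists M1 : R,
    0 < M1 /\ forall y, frontier U y -> `|f y| <= M1.
  exists (`|M| + 1); split; first by rewrite ltr_wpDl.
  move=> y Fy; apply: le_trans (fM y Fy) _.
  by rewrite (le_trans (ler_norm M))// lerDl.
have eM0 : 0 < e / 2 / M1 by rewrite !divr_gt0.
have := kernel_equicontinuous cU hk Ux eM0.
have : \forall x' \near within U (nbhs x), U x' by exact: withinT.
apply: filterS2 => x' Ux' kxx'.
have mF := measurable_frontier (x0 := x0) U.
have F1 := omega_frontier hframe DU Ux0.
have Foo : (omega U x0 (frontier U) < +oo)%E by rewrite F1 ltry.
rewrite /from_subspace/poisson.
rewrite (kernel_density hframe DU regU cU Ux0 hk Ux bf f0).
rewrite (kernel_density hframe DU regU cU Ux0 hk Ux' bf f0).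
have ik z : U z -> (omega U x0).-integrable (frontier U)
    (EFin \o (fun y => f y * k z y)).
  move=> Uz; apply: (omega_integrable hframe DU Ux0 mF) => //.
  by apply: bounded_borelM => //; exact: kernel_bounded_borel hk _ Uz.
apply: le_lt_trans
  (Rintegral_dist_le mF Foo (ik _ Ux) (ik _ Ux') (e := e / 2) _) _.
  move=> y Fy; rewrite -mulrBr normrM.
  have -> : e / 2 = M1 * (e / 2 / M1) by rewrite [RHS]mulrC divfK// gt_eqF.
  by rewrite ler_pM// ?fM1// ltW// kxx'.
by rewrite F1 mulr1; lra.
Qed.

(** By [kernel_near_average] the function k(., y) is, uniformly on the closure
    of V, close to a multiple of x |-> omega_x(A), which is harmonic. *)
Lemma kernel_harmonic y : frontier U y -> harmonic U (k ^~ y).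
Proof.
move=> Fy.
have ck := @within_setX_slice X X R (frontier U) U (fun z x => k x z) y Fy
  (within_setX_swap (proj1 hk)).
apply: harmonic_approx => // V e [cV VU] e0.
have [A [mA AF a0 kA]] :=
  kernel_near_average hframe DU regU cU Ux0 hk cV VU Fy e0.
set a := fine (omega U x0 A) in a0 kA.
(* The zero term brings a multiple into the form of [harmonic_lincomb]. *)
exists (fun x => a^-1 * poisson \1_A x + 0 * 0).
  exists U => //; apply: harmonic_lincomb; last exact: harmonic_cst.
  apply: poisson_harmonic; first exact: bounded_borel_indic.
  by move=> z _; rewrite indicE.
move=> x Vx; rewrite mulr0 addr0 /poisson.
rewrite (Rintegral_omega_indic x mA AF).
have an0 : a != 0 by rewrite gt_eqF.
rewrite -(ler_pM2r a0) -{2}(gtr0_norm a0) -normrM mulrBl mulrAC mulVf// mul1r.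
exact: kA.
Qed.

End poisson_integrals.
End harmonic_functions.

Arguments poisson {R X x0} omega U f x.

(** * Exhaustions and Harnack bounds *)

Section exhaustion.
Context {R : realType} {X : metricType R} {x0 : X} {DD : set (set X)}
  {omega : set X -> X -> {measure set (borel x0) -> \bar R}}.
Variables (D : set X) (Dn : nat -> set X) (K : nat -> X -> X -> R).
Hypotheses (hframe : harmonic_framework DD omega)
  (hDn : forall n, DD (Dn n) /\ regular_for (Dn n) (omega (Dn n)))
  (hx0 : Dn 0%N x0)
  (hincr : forall n, relatively_compact_in (Dn n) (Dn n.+1))
  (hcup : D = \bigcup_n Dn n)
  (hK : forall n, continuous_kernel omega (Dn n) (K n)).
Local Notation harmonic := (Defs.harmonic DD omega).
Local Notation bounded_borel := (bounded_borel (x0 := x0)).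
Local Notation L := (L Dn).
Local Notation kmin := (kmin Dn K).
Local Notation kmax := (kmax Dn K).
Local Notation kosc := (kosc Dn K).
Local Notation T_ := (T_ Dn K).
Local Notation TP := (TP Dn K).
Local Notation Q := (Q DD omega Dn K).
Local Notation P := (P DD omega Dn K).
Local Notation restr := (restr Dn).
Local Notation restrP := (restrP Dn).

Lemma exhaustion_mono m n : (m <= n)%N -> Dn m `<=` Dn n.
Proof.
elim: n => [|n IH]; first by rewrite leqn0 => /eqP ->.
rewrite leq_eqVlt => /predU1P[->//|]; rewrite ltnS => /IH mn x /mn.
exact: relatively_compact_sub (hincr n) x.
Qed.

Lemma exhaustion_lt m n : (m < n)%N -> relatively_compact_in (Dn m) (Dn n).
Proof.
move=> mn; split; first by case: (hincr m).
by move=> x Lx; apply: (exhaustion_mono mn); case: (hincr m) => _; exact.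
Qed.

Lemma exhaustion_x0 n : Dn n x0.
Proof. exact: exhaustion_mono (leq0n n) _ hx0. Qed.

Lemma exhaustion_sub n : Dn n `<=` D.
Proof. by move=> x Dx; rewrite hcup; exists n. Qed.

Lemma exhaustion_relatively_compact n : relatively_compact_in (Dn n) D.
Proof.
split; first by case: (hincr n).
by move=> x Lx; apply: (@exhaustion_sub n.+1); case: (hincr n) => _; exact.
Qed.

Lemma exhaustion_open n : open (Dn n).
Proof. by apply: (DD_open hframe); case: (hDn n). Qed.

Lemma exhaustion_near x : D x -> \forall n \near \oo, Dn n x.
Proof.
rewrite hcup => -[N _ DNx]; exists N => // n /= Nn.
exact: exhaustion_mono Nn _ DNx.
Qed.

Lemma exhaustion_compact (C : set X) : compact C -> C `<=` D ->
  \forall n \near \oo, C `<=` Dn n.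
Proof.
move=> cC CD; have /compact_near_coveringP cov := cC.
apply: (cov _ \oo Dn) => x /CD; rewrite hcup => -[N _ DNx].
exists (Dn N, [set n | (N <= n)%N]) => /=; last first.
  by move=> [x' n]/= [DNx' Nn]; exact: exhaustion_mono Nn _ DNx'.
split; last by exists N.
by apply: open_nbhs_nbhs; split => //; exact: exhaustion_open.
Qed.

Lemma L_compact m : compact (L m).
Proof. by case: (hincr m). Qed.

Lemma L_sub m : L m `<=` Dn m.+1.
Proof. by case: (hincr m). Qed.

Lemma L_x0 m : L m x0.
Proof. exact/subset_closure/exhaustion_x0. Qed.

Lemma kernel_bounded m : exists2 M, 0 < M & forall s z, L m s ->
  frontier (Dn m.+1) z -> `|K m.+1 s z| <= M.
Proof.
have cLF : compact (L m `*` frontier (Dn m.+1)).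
  by apply: compact_setX; [exact: L_compact|exact/frontier_compact/L_compact].
have kc : {within L m `*` frontier (Dn m.+1),
    continuous (fun p : X * X => K m.+1 p.1 p.2)}.
  apply: continuous_subspaceW (proj1 (hK m.+1)) => -[s z] [/= Ls Fz].
  by split => //=; exact: L_sub.
have [M M0 kM] := compact_within_bounded cLF kc.
by exists M => // s z Ls Fz; exact: (kM (s, z)).
Qed.

Lemma kmin_le m s z : L m s -> frontier (Dn m.+1) z -> kmin m <= K m.+1 s z.
Proof.
move=> Ls Fz; apply: ge_inf; last by exists (s, z).
have [M _ kM] := kernel_bounded m; exists (- M) => _ [[s' z'] [/= Ls' Fz'] <-].
by have := kM s' z' Ls' Fz'; rewrite ler_norml => /andP[].
Qed.

Lemma le_kmax m s z : L m s -> frontier (Dn m.+1) z -> K m.+1 s z <= kmax m.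
Proof.
move=> Ls Fz; apply: ub_le_sup; last by exists (s, z).
have [M _ kM] := kernel_bounded m; exists M => _ [[s' z'] [/= Ls' Fz'] <-].
by have := kM s' z' Ls' Fz'; rewrite ler_norml => /andP[].
Qed.

Lemma le_kosc m s t z : L m s -> L m t -> frontier (Dn m.+1) z ->
  `|K m.+1 s z - K m.+1 t z| <= kosc m s t.
Proof.
move=> Ls Lt Fz; apply: ub_le_sup; last by exists z.
have [M _ kM] := kernel_bounded m; exists (M + M) => _ [z' Fz' <-].
by apply: le_trans (ler_normB _ _) _; rewrite lerD ?kM.
Qed.

Lemma frontier_neq0 n : frontier (Dn n) !=set0.
Proof. by case: hframe => /(_ _ (proj1 (hDn n)))[]. Qed.

Lemma kosc_ge0 m s t : L m s -> L m t -> 0 <= kosc m s t.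
Proof.
by move=> Ls Lt; have [z Fz] := frontier_neq0 m.+1;
  exact: le_trans (normr_ge0 _) (le_kosc Ls Lt Fz).
Qed.

Lemma kosc_near m s (e : R) : L m s -> 0 < e ->
  \forall t \near within (L m) (nbhs s), kosc m s t <= e.
Proof.
move=> Ls e0.
have knear : nbhs s (fun t => Dn m.+1 t -> forall z, frontier (Dn m.+1) z ->
    `|K m.+1 s z - K m.+1 t z| < e).
  have := kernel_equicontinuous (@L_compact m.+1) (hK m.+1) (L_sub Ls) e0.
  by rewrite near_withinE; apply.
suff : nbhs s (fun t => L m t -> kosc m s t <= e) by [].
apply: filterS knear => t + Lt => /(_ (L_sub Lt)) kst.
apply: ge_sup; last by move=> _ [z Fz <-]; rewrite ltW// kst.
by have [z Fz] := frontier_neq0 m.+1; exists `|K m.+1 s z - K m.+1 t z|, z.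
Qed.

(** For u >= 0 harmonic around the closure of D_{m+1}, u(s) is the integral of
    K_{m+1}(s,.) against the measure u d(omega_x0), whose total mass is u(x0).
    So bounds on the kernel give bounds on u with the factor u(x0). *)
Section harnack.
Variables (m : nat) (W : set X) (u : X -> R).
Hypotheses (mW : relatively_compact_in (Dn m.+1) W) (hu : harmonic W u)
  (u0 : forall y, frontier (Dn m.+1) y -> 0 <= u y).

Let F := frontier (Dn m.+1).
Let mF : measurable (F : set (borel x0)) := measurable_frontier _.
Let w := omega (Dn m.+1) x0.
Let DU := proj1 (hDn m.+1).

Let bu : bounded_borel F u.
Proof. exact: relatively_compact_bounded_borel mW (proj1 hu). Qed.

Let bk s : L m s -> bounded_borel F (K m.+1 s).
Proof.
move=> Ls; apply: (kernel_bounded_borel (@L_compact m.+1) (hK m.+1)).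
exact: L_sub.
Qed.

Let integrable_w f : bounded_borel F f -> w.-integrable F (EFin \o f).
Proof.
move=> bf.
exact: (omega_integrable hframe DU (exhaustion_x0 _) mF (fun y Fy => Fy) bf).
Qed.

Let mean_u s : L m s -> u s = \int[w]_(y in F) (u y * K m.+1 s y).
Proof.
move=> /L_sub Us; have [_ regU] := hDn m.+1.
rewrite (proj2 hu _ _ DU regU mW Us).
exact: (kernel_density hframe DU regU (@L_compact _) (exhaustion_x0 _) (hK _)
  Us bu u0).
Qed.

Let mean_u0 : u x0 = \int[w]_(y in F) u y.
Proof.
have [_ regU] := hDn m.+1.
exact: (proj2 hu _ _ DU regU mW (exhaustion_x0 _)).
Qed.

Lemma harnack_bounds s : L m s -> kmin m * u x0 <= u s <= kmax m * u x0.
Proof.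
move=> Ls; have iu := integrable_w bu.
have iuk := integrable_w (bounded_borelM bu (bk Ls)).
rewrite (mean_u Ls) mean_u0 -!RintegralZl//.
apply/andP; split; apply: le_Rintegral => //.
- exact: (integrableZl mF _ iu).
- by move=> y Fy; rewrite mulrC; apply: ler_wpM2l; [exact: u0|exact: kmin_le].
- exact: (integrableZl mF _ iu).
- move=> y Fy; rewrite [leRHS]mulrC.
  by apply: ler_wpM2l; [exact: u0|exact: le_kmax].
Qed.

Lemma harnack_oscillation s t : L m s -> L m t ->
  `|u s - u t| <= kosc m s t * u x0.
Proof.
move=> Ls Lt; have iu := integrable_w bu.
have ik r (Lr : L m r) := integrable_w (bounded_borelM bu (bk Lr)).
rewrite (mean_u Ls) (mean_u Lt) mean_u0.
rewrite -RintegralB; [|exact: mF|exact: ik|exact: ik].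
have id : w.-integrable F
    (EFin \o (fun y => u y * K m.+1 s y - u y * K m.+1 t y)).
  by apply: eq_integrable (integrableB mF (ik s Ls) (ik t Lt)).
apply: le_trans (le_normr_Rintegral mF id) _.
rewrite -RintegralZl//; apply: le_Rintegral => //.
- exact: integrable_norm.
- exact: (integrableZl mF _ iu).
- move=> y Fy; rewrite -mulrBr normrM (ger0_norm (u0 Fy)) mulrC.
  by rewrite ler_wpM2r ?u0// le_kosc.
Qed.

End harnack.

(** Continuity is local and the D_n are open; a set V whose closure is compact
    in D has its closure in some D_N. *)
Lemma harmonic_exhaustion (v : X -> R) :
  (forall m, harmonic (Dn m) v) -> harmonic D v.
Proof.
move=> hv; split.
  have oD : open D.
    by rewrite hcup; apply: bigcup_open => n _; exact: exhaustion_open.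
  rewrite continuous_open_subspace// => x /set_mem; rewrite hcup => -[n _ Dx].
  have := proj1 (hv n).
  rewrite continuous_open_subspace; last exact: exhaustion_open.
  by apply; exact: mem_set.
move=> V x DV regV [cV VD] Vx.
have [N _ /(_ N (leqnn N)) VN] := exhaustion_compact cV VD.
exact: (proj2 (hv N)).
Qed.

(** * Compactness of the spaces Q_m and P *)

Lemma L_mono i m : (i <= m)%N -> L i `<=` L m.
Proof. by move=> im; exact/closure_subset/exhaustion_mono. Qed.

Lemma restrK m (u : X -> R) s : L m s -> valL_ 0 (restr m u) s = u s.
Proof.
move=> Ls; have /(congr1 (fun f => f u s))/= -> := sigLK (0 : R) (A := L m).
by rewrite patchE mem_set.
Qed.

Lemma valL_val m (g : CL Dn m) (s : L m) :
  valL_ 0 (g : L m -> R) (set_val s) = g s.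
Proof. exact: (congr1 (fun f => f s) (valLK (0 : R) (g : L m -> R))). Qed.

Lemma restr_continuous m (u : X -> R) : {within L m, continuous u} ->
  continuous (restr m u : L m -> R).
Proof. by move=> /subspace_sigL_continuousP. Qed.

(** This one criterion puts the kernels K_n(., y), the constant 1 and h into
    Q_m. *)
Lemma restr_Q m W (u : X -> R) : relatively_compact_in (Dn m.+1) W ->
  harmonic W u -> (forall x, W x -> 0 <= u x) -> u x0 = 1 -> Q m (restr m u).
Proof.
move=> mW hu u0 u1.
have LW : L m `<=` W.
  exact: subset_trans (L_sub (m := m)) (relatively_compact_sub mW).
split.
- exact/restr_continuous/(continuous_subspaceW LW)/(proj1 hu).
- apply: (@eq_harmonic _ _ _ _ _ _ u).
    by move=> x Dx; rewrite restrK//; exact: subset_closure.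
  apply: sub_harmonic hu; apply: subset_trans LW; exact: subset_closure.
- by rewrite restrK//; exact: L_x0.
- move=> i s t im Ls Lt; rewrite !restrK; try exact: L_mono im _ _.
  have iW : relatively_compact_in (Dn i.+1) W.
    split; first by case: (hincr i.+1).
    case: mW => _; apply: subset_trans.
    exact/closure_subset/exhaustion_mono.
  have u0F y : frontier (Dn i.+1) y -> 0 <= u y.
    by move=> /(relatively_compact_frontier iW); exact: u0.
  have := harnack_bounds iW hu u0F Ls.
  have := harnack_oscillation iW hu u0F Ls Lt.
  by rewrite u1 !mulr1.
Qed.

Lemma ultra_harmonic_limit m (I : Type) (F : set_system I) (u : I -> X -> R)
    (M : R) :
  UltraFilter F ->
  (\forall i \near F, harmonic (Dn m) (u i)) ->
  (\forall i \near F, forall s, L m s -> `|u i s| <= M) ->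
  (\forall i \near F, forall s t, L m s -> L m t ->
    `|u i s - u i t| <= kosc m s t) ->
  let v := fun s => lim (u i s @[i --> F]) in
  [/\ harmonic (Dn m) v, {within L m, continuous v} &
      forall e : R, 0 < e ->
        \forall i \near F, forall s, L m s -> `|u i s - v s| <= e].
Proof.
move=> UF hu uM uosc v.
have uv (e : R) : 0 < e ->
    \forall i \near F, forall s, L m s -> `|u i s - v s| <= e.
  apply: (ultra_equicontinuous_cvg UF (L_compact (m := m)) _ uM uosc).
  move=> s e' Ls e0; exact: (kosc_near Ls e0).
have cv : {within L m, continuous v}.
  apply/subspace_continuousP => s Ls; apply/cvgrPdist_le => e e0.
  have : \forall t \near within (L m) (nbhs s), L m t by exact: withinT.
  have := kosc_near Ls e0.
  apply: filterS2 => t oscst Lt; apply: le_trans oscst.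
  by apply: (ultra_lim_dist (M := M) UF); [move: uM|move: uM|move: uosc];
    apply: filterS => i; apply.
split=> //; apply: (harmonic_approx hframe).
  by apply: continuous_subspaceW cv; exact: subset_closure.
move=> V e VD e0; have [i [hui uvi]] := filter_ex (filterI hu (uv e e0)).
exists (u i); first by exists (Dn m).
by move=> x Vx; apply: uvi; apply: subset_closure; case: VD => _; apply.
Qed.

Lemma Q_compact m : compact (Q m).
Proof.
rewrite compact_ultra => F UF FQ.
pose u (g : CL Dn m) : X -> R := valL_ 0 (g : L m -> R).
pose v s := lim (u g s @[g --> F]).
have FP : forall A, (forall g, Q m g -> A g) -> F A.
  by move=> A QA; apply: filterS FQ.
pose M := `|kmin m| + `|kmax m|.
have uM : \forall g \near F, forall s, L m s -> `|u g s| <= M.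
  apply: FP => g [_ _ _ gb] s Ls.
  have [/andP[lo hi] _] := gb m s s (leqnn m) Ls Ls.
  move: lo hi; rewrite /M/u ler_norml.
  have := ler_norm (kmax m); have := ler_norm (- kmin m); rewrite normrN.
  have := normr_ge0 (kmin m); have := normr_ge0 (kmax m); lra.
have uosc : \forall g \near F, forall s t, L m s -> L m t ->
    `|u g s - u g t| <= kosc m s t.
  by apply: FP => g [_ _ _ gb] s t Ls Lt; have [] := gb m s t (leqnn m) Ls Lt.
have hu : \forall g \near F, harmonic (Dn m) (u g) by apply: FP => g [].
have [hv cv uv] := ultra_harmonic_limit UF hu uM uosc.
have ucvg s : L m s -> u g s @[g --> F] --> v s.
  move=> Ls; apply: (ultra_bounded_cvg (M := M) UF).
  by apply: filterS uM => g; apply.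
exists (restr m v); split.
  split.
  - exact: restr_continuous.
  - by apply: eq_harmonic hv => x Dx; rewrite restrK//; exact: subset_closure.
  - rewrite restrK; last exact: L_x0.
    apply: (@cvg_lim _ (@Rhausdorff R)).
    by apply: cvg_near_cst; apply: FP => g [].
  - move=> i s t im Ls Lt; have [Lms Lmt] := (L_mono im Ls, L_mono im Lt).
    rewrite !restrK//; split.
      have := ucvg s Lms => us; rewrite -(cvg_lim (@Rhausdorff R) us).
      have cus := cvgP _ us.
      apply/andP; split; [apply: limr_ge => //|apply: limr_le => //];
        by apply: FP => g [_ _ _ gb]; have [/andP[]] := gb i s t im Ls Lt.
    apply: (ultra_lim_dist (M := M) UF); [move: uM|move: uM|].
    + by apply: filterS => g; apply.
    + by apply: filterS => g; apply.
    + by apply: FP => g [_ _ _ gb]; have [] := gb i s t im Ls Lt.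
move=> A /uniform_nbhsP[e e0 eA]; suff : F A by [].
apply: filterS (uv e e0) => g uvg; apply: eA => s.
rewrite distrC -valL_val; apply: uvg; exact: set_valP.
Qed.

Lemma Q_closed m : closed (Q m).
Proof. by apply: compact_closed (@Q_compact m); exact: uniform_hausdorff. Qed.

Lemma P_compact : compact P.
Proof. exact: (@tychonoff _ _ (fun m => Q m) Q_compact). Qed.

Lemma P_closed : closed P.
Proof.
apply: compact_closed P_compact; apply: hausdorff_product => m.
exact: uniform_hausdorff.
Qed.

(** * Parts of an extreme harmonic function *)

Variable h : X -> R.
Hypothesis hh : extreme_H1 DD omega D h.
Local Notation nu := (Defs.nu omega Dn h).

Let D0 : D x0. Proof. exact: (exhaustion_sub (exhaustion_x0 0)). Qed.
Let hharm : harmonic D h. Proof. by case: hh => -[]. Qed.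
Let h_gt0 x : D x -> 0 < h x. Proof. by case: hh => -[_ + _] _; exact. Qed.
Let h_x0 : h x0 = 1. Proof. by case: hh => -[]. Qed.

(** h is the convex combination with weights (1 + t)/3 and (2 - t)/3 of the
    normalised functions (h + w)/(1 + t) and (2h - w)/(2 - t).  Mixing h into
    w and h - w makes both strictly positive without a minimum principle. *)
Lemma extreme_minimal (w : X -> R) : harmonic D w ->
  (forall x, D x -> 0 <= w x <= h x) -> forall x, D x -> w x = w x0 * h x.
Proof.
move=> hw w0h x Dx; set t := w x0.
have /andP[t0 t1] := w0h x0 D0; rewrite h_x0 in t1.
have p1 : 0 < 1 + t by rewrite /t; lra.
have p2 : 0 < 2 - t by rewrite /t; lra.
pose f x := (1 + t)^-1 * h x + (1 + t)^-1 * w x.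
pose g x := ((2 - t)^-1 * 2) * h x + - (2 - t)^-1 * w x.
have Hf : H1 DD omega D f.
  split; first exact: harmonic_lincomb.
    move=> z Dz; rewrite /f -mulrDr mulr_gt0 ?invr_gt0//.
    by have /andP[wz _] := w0h z Dz; have := h_gt0 Dz; lra.
  by rewrite /f -mulrDr h_x0 mulVf// gt_eqF.
have gE z : g z = (2 - t)^-1 * (2 * h z - w z) by rewrite /g mulrBr mulrA mulNr.
have Hg : H1 DD omega D g.
  split; first exact: harmonic_lincomb.
    move=> z Dz; rewrite gE mulr_gt0 ?invr_gt0//.
    by have /andP[_ wz] := w0h z Dz; have := h_gt0 Dz; lra.
  by rewrite gE h_x0 mulr1 mulVf// gt_eqF.
have tau01 : 0 < (1 + t) / 3 < 1 by rewrite /t; lra.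
have [_ ext] := hh.
have [|fh _] := ext f g ((1 + t) / 3) Hf Hg tau01.
  by move=> z _; rewrite /f /g; field; rewrite !gt_eqF.
have := fh x (mem_set Dx); rewrite /f -mulrDr => /(congr1 ( *%R (1 + t))).
by rewrite mulrA divff ?gt_eqF// mul1r; lra.
Qed.

(** The harmonic function on D_n whose boundary values are those of h on A and 0
    elsewhere.  Its value at x0 is the mass of A for h d(omega_x0)
    ([nu_harmonic_part]), so that the maps A |-> harmonic_part n A x0 serve as
    real-valued versions of the measures nu_n. *)
Definition harmonic_part (n : nat) (A : set X) : X -> R :=
  poisson omega (Dn n) (fun y => h y * \1_A y).

Let bh n : bounded_borel (frontier (Dn n)) h.
Proof.
apply: relatively_compact_bounded_borel (proj1 hharm).
exact: exhaustion_relatively_compact.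
Qed.

Let h_ge0 n y : frontier (Dn n) y -> 0 <= h y.
Proof.
move=> Fy; apply/ltW/h_gt0.
exact: (relatively_compact_frontier (exhaustion_relatively_compact n)).
Qed.

Section harmonic_part.
Variables (n : nat) (A : set X).
Hypothesis mA : measurable (A : set (borel x0)).

Lemma harmonic_part_bounded_borel :
  bounded_borel (frontier (Dn n)) (fun y => h y * \1_A y).
Proof. by apply: bounded_borelM; [exact: bh|exact: bounded_borel_indic]. Qed.

Lemma harmonic_part_density_ge0 y : frontier (Dn n) y -> 0 <= h y * \1_A y.
Proof. by move=> /h_ge0 hy; rewrite mulr_ge0// indicE. Qed.

Lemma harmonic_part_is_harmonic : harmonic (Dn n) (harmonic_part n A).
Proof.
have [DU regU] := hDn n.
apply: (poisson_harmonic hframe DU regU (L_compact (m := n))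
  (exhaustion_x0 n) (hK n)).
  exact: harmonic_part_bounded_borel.
exact: harmonic_part_density_ge0.
Qed.

Lemma harmonic_part_ge0 x : 0 <= harmonic_part n A x.
Proof. by apply: Rintegral_ge0 => y; exact: harmonic_part_density_ge0. Qed.

Lemma harmonic_part_le x : Dn n x -> harmonic_part n A x <= h x.
Proof.
move=> Dx; have [DU regU] := hDn n.
have mF : measurable (frontier (Dn n) : set (borel x0)) := measurable_frontier _.
rewrite (proj2 hharm _ _ DU regU (exhaustion_relatively_compact n) Dx).
apply: le_Rintegral => //.
- exact: (omega_integrable hframe DU Dx mF _ harmonic_part_bounded_borel).
- exact: (omega_integrable hframe DU Dx mF _ (bh n)).
- by move=> y /h_ge0 hy; rewrite ler_piMr// indicE; case: (_ \in _).
Qed.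

End harmonic_part.

(** Along an ultrafilter the parts converge to a harmonic function between 0 and
    h; by minimality it is a multiple of h, the factor being its value
    at x0. *)
Lemma harmonic_part_cvg (A : nat -> set X) s :
  (\forall n \near \oo, measurable (A n : set (borel x0))) -> D s ->
  harmonic_part n (A n) s - harmonic_part n (A n) x0 * h s @[n --> \oo] -->
    (0 : R).
Proof.
move=> mA Ds; apply/cvgrPdist_le => e e0.
apply: near_ultra => F UF ooF.
pose u n := harmonic_part n (A n); pose v x := lim (u n x @[n --> F]).
have Fge N : F [set n | (N <= n)%N] by apply: ooF; exists N.
have {}mA : \forall n \near F, measurable (A n : set (borel x0)) by exact: ooF.
have u01 x : D x -> \forall n \near F, 0 <= u n x <= h x.
  move=> Dx; apply: filterS2 mA (ooF _ (exhaustion_near Dx)) => n mAn Dnx.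
  by rewrite harmonic_part_ge0 harmonic_part_le.
have hL m : {within L m, continuous h}.
  apply: continuous_subspaceW (proj1 hharm).
  by case: (exhaustion_relatively_compact m).
(* The factor u n x0 <= h x0 = 1 in the Harnack bounds is dropped. *)
have lim_u m : exists M, [/\ \forall n \near F, harmonic (Dn m) (u n),
    \forall n \near F, forall x, L m x -> `|u n x| <= M &
    \forall n \near F, forall x y, L m x -> L m y ->
      `|u n x - u n y| <= kosc m x y].
  have [M _ hM] := compact_within_bounded (L_compact (m := m)) (hL m).
  exists M; split; apply: filterS2 mA (Fge m.+2) => n mAn /= mn.
  - apply: sub_harmonic (harmonic_part_is_harmonic n mAn).
    by apply: exhaustion_mono; rewrite (leq_trans _ mn)// leqW.
  - move=> x Lx; rewrite ger0_norm ?harmonic_part_ge0//.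
    apply: (@le_trans _ _ (h x)); last exact: le_trans (ler_norm _) (hM _ Lx).
    apply: harmonic_part_le => //; apply: (exhaustion_mono _ (L_sub Lx)).
    exact: leq_trans mn.
  - move=> x y Lx Ly.
    have mW := exhaustion_lt mn.
    have := harnack_oscillation mW (harmonic_part_is_harmonic n mAn)
      (fun y _ => harmonic_part_ge0 n (A n) y) Lx Ly.
    move=> /le_trans; apply; rewrite ler_piMr//; first exact: kosc_ge0.
    by rewrite -h_x0; apply: harmonic_part_le => //; exact: (exhaustion_x0 n).
have hv : harmonic D v.
  apply: harmonic_exhaustion => m.
  have [M [hu uM uosc]] := lim_u m.
  by have [] := ultra_harmonic_limit UF hu uM uosc.
have ucvg x : D x -> u n x @[n --> F] --> v x.
  move=> Dx; apply: (ultra_bounded_cvg UF (M := h x)).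
  by apply: filterS (u01 x Dx) => n /andP[? ?]; rewrite ger0_norm.
have v01 x : D x -> 0 <= v x <= h x.
  move=> Dx; have ux := cvgP _ (ucvg x Dx).
  by apply/andP; split; [apply: limr_ge => //|apply: limr_le => //];
    apply: filterS (u01 x Dx) => n /andP[].
have : u n s - u n x0 * h s @[n --> F] --> v s - v x0 * h s.
  by apply: cvgB; [exact: ucvg|apply: cvgMl; exact: ucvg].
rewrite -(extreme_minimal hv v01 Ds) subrr => /cvgrPdist_le; exact.
Qed.

(** * Convergence in probability of the kernels *)

Let F n : set X := frontier (Dn n).
Let mF n : measurable (F n : set (borel x0)) := measurable_frontier _.
Let DU n : DD (Dn n) := proj1 (hDn n).
Let Dnx0 n : Dn n x0 := exhaustion_x0 n.

Let bhA n A (mA : measurable (A : set (borel x0))) :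
    bounded_borel (F n) (fun y => h y * \1_A y) :=
  harmonic_part_bounded_borel n mA.
Let hA_ge0 n (A : set X) y : F n y -> 0 <= h y * \1_A y.
Proof. exact: (harmonic_part_density_ge0 (n := n) A). Qed.

Let integrable_hA n A (mA : measurable (A : set (borel x0))) :
  (omega (Dn n) x0).-integrable (F n) (EFin \o (fun y => h y * \1_A y)).
Proof.
exact: (omega_integrable hframe (DU n) (Dnx0 n) (mF n) (fun y Fy => Fy)
  (bhA n mA)).
Qed.

Lemma harmonic_part_set0 n x : harmonic_part n set0 x = 0.
Proof.
rewrite /harmonic_part /poisson; under eq_Rintegral do rewrite indic0 mulr0.
by rewrite (Rintegral_cst _ (mF n) 0) mul0r.
Qed.

Lemma harmonic_part_mono n (A B : set X) : measurable (A : set (borel x0)) ->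
  measurable (B : set (borel x0)) -> A `<=` B ->
  harmonic_part n A x0 <= harmonic_part n B x0.
Proof.
move=> mA mB AB.
apply: le_Rintegral; [exact: mF|exact: integrable_hA|exact: integrable_hA|].
move=> y Fy; rewrite !indicE; have [/set_mem/AB/mem_set ->//|yA] := boolP (y \in A).
by have := hA_ge0 B Fy; rewrite indicE mulr0.
Qed.

Lemma harmonic_part_setU n (A B : set X) : measurable (A : set (borel x0)) ->
  measurable (B : set (borel x0)) ->
  harmonic_part n (A `|` B) x0 <= harmonic_part n A x0 + harmonic_part n B x0.
Proof.
move=> mA mB.
rewrite -RintegralD; [|exact: mF|exact: integrable_hA|exact: integrable_hA].
apply: le_Rintegral.
- exact: mF.
- exact: (integrable_hA n (measurableU _ _ mA mB)).
- by apply: eq_integrable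
    (integrableD (mF n) (integrable_hA n mA) (integrable_hA n mB)).
- move=> y Fy; have := hA_ge0 setT Fy; rewrite !indicE in_setT mulr1 in_setU => h0.
  by case: (y \in A); case: (y \in B); rewrite /= ?mulr1 ?mulr0; lra.
Qed.

(** The eventual events: the sets of pairs (n, y) whose complement has
    nu_n-measure tending to 0.  Convergence in probability is convergence
    along this filter, so that the covering lemmas for compact sets and the
    description of the product topology apply to it as they stand.  The
    complement is covered by a Borel set B because it need not be Borel. *)
Definition in_probability : set_system (nat * X) :=
  [set S | forall e : R, 0 < e -> \forall n \near \oo, exists B : set X,
    [/\ measurable (B : set (borel x0)),
        forall y, F n y -> ~ S (n, y) -> B y & harmonic_part n B x0 <= e]].
Local Notation Pr := in_probability.

#[local] Instance in_probability_filter : Filter Pr.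
Proof.
split.
- move=> e e0; near=> n; exists set0; split => //; first by move=> y _ [].
  by rewrite harmonic_part_set0 ltW.
- move=> S1 S2 P1 P2 e e0; have e20 : 0 < e / 2 by rewrite divr_gt0.
  apply: filterS2 (P1 _ e20) (P2 _ e20) => n [B1 [mB1 SB1 pB1]] [B2 [mB2 SB2 pB2]].
  exists (B1 `|` B2); split; first exact: measurableU.
    by move=> y Fy /not_andP[/(SB1 _ Fy)|/(SB2 _ Fy)]; [left|right].
  by apply: le_trans (harmonic_part_setU n mB1 mB2) _; lra.
- move=> S1 S2 S12 P1 e e0; apply: filterS (P1 e e0) => n [B [mB SB pB]].
  by exists B; split => // y Fy nS2; apply: SB => // /S12.
Unshelve. all: by end_near. Qed.

Lemma in_probability_frontier : \forall p \near Pr, F p.1 p.2.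
Proof.
move=> e e0; near=> n; exists set0; split => //.
by rewrite harmonic_part_set0 ltW.
Unshelve. all: by end_near. Qed.

Lemma in_probability_ge N : \forall p \near Pr, (N <= p.1)%N.
Proof.
move=> e e0; near=> n; exists set0; split => //; last first.
  by rewrite harmonic_part_set0 ltW.
by move=> y _ []/=; near: n; exists N.
Unshelve. all: by end_near. Qed.

Section kernel_bounds.
Variables (n : nat) (s : X) (A : set X) (c : R).
Hypotheses (mA : measurable (A : set (borel x0))) (Ds : Dn n s).

Let part_kernelE : harmonic_part n A s =
  \int[omega (Dn n) x0]_(y in F n) (h y * \1_A y * K n s y).
Proof.
have [_ regU] := hDn n; have Lc := @L_compact n.
exact: (kernel_density hframe (DU n) regU Lc (Dnx0 n) (hK n) Ds
  (bhA n mA) (hA_ge0 A (n := n))).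
Qed.

Let integrable_hAK : (omega (Dn n) x0).-integrable (F n)
  (EFin \o (fun y => h y * \1_A y * K n s y)).
Proof.
apply: (omega_integrable hframe (DU n) (Dnx0 n) (mF n)) => //.
apply: bounded_borelM; first exact: bhA.
exact: kernel_bounded_borel (@L_compact n) (hK n) _ Ds.
Qed.

Lemma harmonic_part_kernel_ge : (forall y, F n y -> A y -> c <= K n s y) ->
  c * harmonic_part n A x0 <= harmonic_part n A s.
Proof.
have ihA := integrable_hA n mA.
move=> cA; rewrite part_kernelE -RintegralZl; [|exact: mF|exact: ihA].
apply: le_Rintegral; [exact: mF|exact: (integrableZl (mF n) _ ihA)|
  exact: integrable_hAK|].
move=> y Fy; rewrite mulrC; have [yA|yA] := pselect (A y).
  by apply: ler_wpM2l; [exact: hA_ge0 Fy|exact: cA].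
by rewrite indicE memNset//= mulr0n mulr0 !mul0r.
Qed.

Lemma harmonic_part_kernel_le : (forall y, F n y -> A y -> K n s y <= c) ->
  harmonic_part n A s <= c * harmonic_part n A x0.
Proof.
have ihA := integrable_hA n mA.
move=> cA; rewrite part_kernelE -RintegralZl; [|exact: mF|exact: ihA].
apply: le_Rintegral; [exact: mF|exact: integrable_hAK|
  exact: (integrableZl (mF n) _ ihA)|].
move=> y Fy; rewrite [leRHS]mulrC; have [yA|yA] := pselect (A y).
  by apply: ler_wpM2l; [exact: hA_ge0 Fy|exact: cA].
by rewrite indicE memNset//= mulr0n mulr0 !mul0r.
Qed.

End kernel_bounds.

(** On A_n = {K_n(s,.) >= h(s) + d} the part of h satisfies
    w_n(A_n)(s) >= (h(s) + d) nu_n(A_n), whereas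
    w_n(A_n)(s) - nu_n(A_n) h(s) -> 0; hence d nu_n(A_n) -> 0.  The sets
    B_n = {K_n(s,.) <= h(s) - d} are symmetric. *)
Lemma kernel_cvg_in_probability s : D s -> K p.1 s p.2 @[p --> Pr] --> h s.
Proof.
move=> Ds; apply/cvgrPdist_lt => d d0.
pose A n := F n `&` K n s @^-1` `[h s + d, +oo[%classic.
pose B n := F n `&` K n s @^-1` `]-oo, h s - d]%classic.
have nDs := exhaustion_near Ds.
have mK n : Dn n s ->
    measurable_fun (F n : set (borel x0)) (K n s : borel x0 -> R).
  move=> Dns.
  by case: (kernel_bounded_borel (L_compact (m := n)) (hK n) Dns).
have mA : \forall n \near \oo, measurable (A n : set (borel x0)).
  by apply: filterS nDs => n Dns; exact: mK.
have mB : \forall n \near \oo, measurable (B n : set (borel x0)).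
  by apply: filterS nDs => n Dns; exact: mK.
move=> e e0; have ed0 : 0 < d * (e / 2) by rewrite mulr_gt0// divr_gt0.
have /cvgrPdist_le/(_ _ ed0) := harmonic_part_cvg mA Ds.
have /cvgrPdist_le/(_ _ ed0) := harmonic_part_cvg mB Ds.
move=> pB pA; near=> n.
have Dns : Dn n s by near: n.
have mAn : measurable (A n : set (borel x0)) by near: n.
have mBn : measurable (B n : set (borel x0)) by near: n.
have pAn : `|0 - (harmonic_part n (A n) s - harmonic_part n (A n) x0 * h s)|
  <= d * (e / 2) by near: n.
have pBn : `|0 - (harmonic_part n (B n) s - harmonic_part n (B n) x0 * h s)|
  <= d * (e / 2) by near: n.
exists (A n `|` B n); split; first exact: measurableU.
  move=> y Fy /= /negP; rewrite -leNgt ler_normr => /orP[hK1|hK1]; [right|left];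
    split => //=; rewrite in_itv/= ?andbT; lra.
apply: le_trans (harmonic_part_setU n mAn mBn) _.
have lA : (h s + d) * harmonic_part n (A n) x0 <= harmonic_part n (A n) s.
  apply: harmonic_part_kernel_ge => // y _ [_ /=]; by rewrite in_itv/= andbT.
have lB : harmonic_part n (B n) s <= (h s - d) * harmonic_part n (B n) x0.
  by apply: harmonic_part_kernel_le => // y _ [_ /=]; rewrite in_itv.
suff [] : harmonic_part n (A n) x0 <= e / 2 /\
  harmonic_part n (B n) x0 <= e / 2 by lra.
move: pAn pBn; rewrite !ler_norml => pAn pBn.
by split; rewrite -(ler_pM2l d0); nra.
Unshelve. all: by end_near. Qed.

(** Pointwise convergence in probability is uniform on L_m, because
    kosc bounds the oscillation of all the K_n(., y) with n >= m + 2 at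
    once. *)
Lemma T_cvg_in_probability m : T_ p.1 m p.2 @[p --> Pr] --> restr m h.
Proof.
move=> A /uniform_nbhsP[e e0 eA].
suff H : \forall p \near Pr, forall s, L m s -> `|h s - K p.1 s p.2| <= e.
  suff : Pr (fun p => A (T_ p.1 m p.2)) by [].
  have FPr : Filter Pr := in_probability_filter.
  apply: (@filterS _ Pr FPr _ _ _ H) => -[n y] /= hKe; apply: eA => s.
  by apply: hKe; exact: set_valP.
have /compact_near_coveringP/near_covering_withinP cov := L_compact (m := m).
apply: (cov _ Pr (fun p s => `|h s - K p.1 s p.2| <= e)) => s Ls.
have LD : L m `<=` D by case: (exhaustion_relatively_compact m).
have e30 : 0 < e / 3 by rewrite divr_gt0.
have hL : {within L m, continuous h} := continuous_subspaceW LD (proj1 hharm).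
have /subspace_continuousP/(_ s Ls)/cvgrPdist_le/(_ _ e30) hs := hL.
have os := kosc_near Ls e30.
have /cvgrPdist_le/(_ _ e30) Ks := kernel_cvg_in_probability (LD _ Ls).
exists ([set t | L m t -> `|h s - h t| <= e / 3 /\ kosc m s t <= e / 3],
  [set p | [/\ F p.1 p.2, (m.+2 <= p.1)%N & `|h s - K p.1 s p.2| <= e / 3]]) => /=.
  split; first exact: (filterI hs os).
  by apply: filterS3 in_probability_frontier (in_probability_ge m.+2) Ks => p.
move=> [t [n y]]/= [tL [Fy mn hKs]] Lt; have [hst ost] := tL Lt.
have [_ regU] := hDn n.
have Lc := L_compact (m := n).
have Kh := kernel_harmonic hframe (DU n) regU Lc (Dnx0 n) (hK n) Fy.
have mW := exhaustion_lt mn.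
have K0 z : F m.+1 z -> 0 <= K n z y.
  move=> /(relatively_compact_frontier mW) Dz.
  exact: (kernel_ge0 hframe (DU n) regU Lc (Dnx0 n) (hK n)).
have := harnack_oscillation mW Kh K0 Ls Lt.
rewrite (kernel_normalized hframe (DU n) regU Lc (Dnx0 n) (hK n) Fy) mulr1.
move: hst ost hKs; rewrite !ler_norml; lra.
Qed.

Lemma TP_cvg_in_probability : TP p.1 p.2 @[p --> Pr] --> restrP h.
Proof.
apply: cvg_product => m A mA.
have TA : Pr (fun p => A (T_ p.1 m p.2)) by exact: (T_cvg_in_probability mA).
suff : Pr (fun p => A (TP p.1 p.2 m)) by [].
apply: filterS2 (in_probability_ge m.+2) TA.
by move=> [n y] /= mn; rewrite /TP mn.
Qed.

Lemma T_continuous m n : (m < n)%N -> {within F n, continuous (T_ n m)}.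
Proof.
move=> mn; apply/subspace_continuousP => y Fy A /uniform_nbhsP[e e0 eA].
have LD : L m `<=` Dn n by case: (exhaustion_lt mn).
have Kn := compact_slices_equicontinuous (L_compact (m := m)) LD Fy
  (proj1 (hK n)) e0.
suff : within (F n) (nbhs y) (fun y' => A (T_ n m y')) by [].
by apply: filterS Kn => y' yy'; apply: eA => s; apply/ltW/yy'; exact: set_valP.
Qed.

Lemma TP_continuous n : {within F n, continuous (TP n)}.
Proof.
apply/subspace_continuousP => y Fy; apply: cvg_product => m.
rewrite /from_subspace /TP.
case: ifPn => mn; last exact: cvg_cst.
by have /subspace_continuousP := T_continuous (ltnW mn); apply.
Qed.

Lemma T_Q m n y : (m.+2 <= n)%N -> F n y -> Q m (T_ n m y).
Proof.
move=> mn Fy; have [_ regU] := hDn n; have Lc := L_compact (m := n).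
apply: (restr_Q (exhaustion_lt mn)).
- exact: (kernel_harmonic hframe (DU n) regU Lc (Dnx0 n) (hK n)).
- by move=> x Dx; exact: (kernel_ge0 hframe (DU n) regU Lc (Dnx0 n) (hK n)).
- exact: (kernel_normalized hframe (DU n) regU Lc (Dnx0 n) (hK n)).
Qed.

Lemma TP_P n y : F n y -> P (TP n y).
Proof.
move=> Fy m; rewrite /TP; case: ifPn => mn; first exact: T_Q.
apply: (@restr_Q m _ (fun=> 1) (exhaustion_lt (ltnSn m.+1))) => //.
exact: harmonic_cst.
Qed.

Lemma restr_h_Q m : Q m (restr m h).
Proof.
have [[_ h0 h1] _] := hh.
apply: (restr_Q (exhaustion_relatively_compact m.+1) hharm) => //.
by move=> x /h0/ltW.
Qed.

(** * Weak convergence of the image measures *)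

Lemma nu_harmonic_part n (A : set X) : measurable (A : set (borel x0)) ->
  nu n A = (harmonic_part n A x0)%:E.
Proof.
move=> mA; rewrite /harmonic_part /poisson /Rintegral fineK; last first.
  by apply: integrable_fin_num; [exact: mF|exact: integrable_hA].
rewrite /Defs.nu integral_mkcondr; apply: eq_integral => y _.
by rewrite patchE indicE; case: (_ \in _); rewrite ?mulr1 ?mulr0.
Qed.

Lemma nu_frontier n : nu n (F n) = 1%E.
Proof.
have [_ regU] := hDn n; have nD := exhaustion_relatively_compact n.
have mean_h := proj2 hharm _ _ (DU n) regU nD (Dnx0 n).
rewrite /Defs.nu setIid -h_x0 mean_h /Rintegral fineK//.
apply: integrable_fin_num; first exact: mF.
apply: (omega_integrable hframe (DU n) (Dnx0 n) (mF n) (fun y Fy => Fy)).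
exact: relatively_compact_bounded_borel nD (proj1 hharm).
Qed.

Lemma nu_off_frontier n (A : set X) :
  (forall y, F n y -> ~ A y) -> nu n A = 0%E.
Proof.
move=> FA; rewrite /Defs.nu (_ : _ `&` _ = set0) ?integral_set0//.
by apply/seteqP; split => // y [/FA].
Qed.

Lemma nu_setI n (A : set X) : nu n (F n `&` A) = nu n A.
Proof. by rewrite /Defs.nu setIA setIid. Qed.

(** T may fail to be measurable off the frontier.  Replacing it there by z0
    does not change the images of Borel sets, as nu_n lives on the
    frontier. *)
Lemma image_measure_exists (Z : topologicalType) (z0 : Z) n (T : X -> Z) :
  {within F n, continuous T} ->
  exists mu : {measure set (borel z0) -> \bar R}, forall B, measurable B ->
    pushforward (nu n) (T : borel x0 -> borel z0) B = mu B.
Proof.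
move=> cT.
pose T' : borel x0 -> borel z0 := (T : borel x0 -> borel z0) \_ (F n).
have mT' : measurable_fun setT T'.
  apply/(measurable_restrictT _ (mF n)).
  by apply: within_continuous_borel => //; exact: frontier_closed.
pose g : borel x0 -> R := h \_ (F n).
have nD := exhaustion_relatively_compact n.
have mg : measurable_fun setT g.
  apply/(measurable_restrictT _ (mF n)).
  by have [] := relatively_compact_bounded_borel (x0 := x0) nD (proj1 hharm).
have g0 y : 0 <= g y.
  rewrite /g patchE; case: ifPn => // /set_mem Fy.
  have [[_ hpos _] _] := hh.
  exact/ltW/hpos/(relatively_compact_frontier nD).
(* [T'] takes the value z0, the distinguished point of [borel z0], off F n. *)
exists [the measure _ _ of weighted_image (omega (Dn n) x0) mT' mg g0] => B mB.
rewrite /pushforward /Defs.nu /= /weighted_image.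
have -> : F n `&` T @^-1` B = T' @^-1` B `&` F n.
  rewrite setIC; apply/seteqP; split => y [/= By Fy]; split => //; move: By;
    by rewrite /T' patchE mem_set.
by rewrite integral_mkcondr; apply: eq_integral => y _; rewrite restrict_EFin.
Qed.

(** Phi is bounded by compactness of S, and it is e/2-close to Phi(z0) except on
    a subset [Bad] of S whose mass tends to 0 by convergence in
    probability. *)
Lemma pushforward_integral_cvg (Z : topologicalType) (z0 : Z) (S : set Z)
    (T : nat -> X -> Z) (N : nat) : compact S -> closed S -> S z0 ->
  (forall n y, (N <= n)%N -> F n y -> S (T n y)) ->
  (forall n, (N <= n)%N -> {within F n, continuous (T n)}) ->
  T p.1 p.2 @[p --> Pr] --> z0 ->
  forall Phi : Z -> R, {within S, continuous Phi} ->
    (\int[pushforward (nu n) (T n : borel x0 -> borel z0)]_(z in S) (Phi z)%:E)%E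
      @[n --> \oo] --> (Phi z0)%:E.
Proof.
move=> cS clS Sz0 TS Tc Tz0 Phi cPhi.
have mS : measurable (S : set (borel z0)) by exact: borel_closed.
have mPhi : measurable_fun (S : set (borel z0)) (Phi : borel z0 -> R).
  exact: within_continuous_measurable.
have [M M0 PhiM] := compact_within_bounded cS cPhi.
have PhiM2 z : S z -> `|Phi z - Phi z0| <= 2 * M.
  move=> Sz; apply: le_trans (ler_normB _ _) _.
  by have := PhiM z Sz; have := PhiM z0 Sz0; lra.
pose I n :=
  (\int[pushforward (nu n) (T n : borel x0 -> borel z0)]_(z in S) (Phi z)%:E)%E.
have Ifin n : (N <= n)%N -> exists2 mu : {measure set (borel z0) -> \bar R},
    (forall B, measurable B -> mu B = nu n (T n @^-1` B)) &
    I n = (\int[mu]_(z in S) Phi z)%:E /\ mu S = 1%E.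
  move=> Nn; have [mu muE] := image_measure_exists z0 (Tc n Nn).
  have muS : mu S = 1%E.
    rewrite -muE// /pushforward -(nu_frontier n) -nu_setI; congr (nu n _).
    by apply/setIidPl => y Fy; exact: TS.
  exists mu; first by move=> B /muE.
  split=> //; rewrite /I (eq_integral_measurable _ _ muE) /Rintegral fineK//.
  apply: integrable_fin_num => //; apply: measurable_bounded_integrable => //.
    by rewrite muS ltry.
  exists M; split; first exact: num_real.
  by move=> N' NN' z Sz /=; rewrite (le_trans (PhiM _ Sz))// ltW.
apply/fine_cvgP; split.
  exists N => // n /= Nn; have [mu _ [InE _]] := Ifin n Nn.
  by move: InE; rewrite /I => ->.
apply/cvgrPdist_le => e e0; have e20 : 0 < e / 2 by rewrite divr_gt0.
pose Bad := S `&` [set z | e / 2 < `|Phi z - Phi z0|].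
have mBad : measurable (Bad : set (borel z0)).
  have mdiff :
      measurable_fun (S : set (borel z0)) (fun z => `|Phi z - Phi z0| : R).
    by apply: measurableT_comp => //; exact: measurable_funB.
  have -> : Bad = S `&` (fun z => `|Phi z - Phi z0|) @^-1` `]e / 2, +oo[%classic.
    by apply/seteqP; split => z [Sz /=]; rewrite in_itv/= andbT.
  exact: mdiff.
have good : Pr (fun p => S (T p.1 p.2) -> `|Phi (T p.1 p.2) - Phi z0| <= e / 2).
  have /subspace_continuousP/(_ z0 Sz0)/cvgrPdist_le/(_ _ e20) near0 := cPhi.
  have near1 : nbhs z0 (fun z => S z -> `|Phi z0 - Phi z| <= e / 2).
    exact: near0.
  have := Tz0 _ near1.
  apply: (@filterS _ _ in_probability_filter).
  by move=> p Sp /Sp; rewrite distrC.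
have eM0 : 0 < e / 2 / (2 * M) by rewrite !divr_gt0// mulr_gt0.
apply: filterS2 (good _ eM0) (nbhs_infty_ge N) => n [B [mB goodB pB]] /= Nn.
have [mu muE [InE muS]] := Ifin n Nn.
move: InE; rewrite /I /= => ->; rewrite distrC.
apply: le_trans (Rintegral_concentrated mS mBad muS mPhi _ (ltW e20) PhiM2 _) _.
- by rewrite mulr_ge0// ltW.
- by move=> z Sz nBad; rewrite leNgt; apply/negP => bad; apply: nBad; split.
have SBad : S `&` Bad = Bad by apply/setIidPr => z [].
have mTBad : measurable (F n `&` T n @^-1` Bad : set (borel x0)).
  have cF : closed (F n) by exact: frontier_closed.
  exact: (within_continuous_borel (t0 := x0) (z0 := z0) cF (Tc n Nn) (mF n) mBad).
have muBad : fine (mu (S `&` Bad)) <= e / 2 / (2 * M).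
  rewrite SBad muE// -nu_setI nu_harmonic_part//=.
  apply: le_trans pB; apply: harmonic_part_mono => //.
  move=> y [Fy /= [STy bad]]; apply: goodB => //= /(_ STy).
  by rewrite leNgt bad.
apply: (@le_trans _ _ (e / 2 + 2 * M * (e / 2 / (2 * M)))).
  by rewrite lerD2l ler_wpM2l// mulr_ge0// ltW.
have MN0 : 2 * M != 0 by rewrite gt_eqF// mulr_gt0.
by rewrite [2 * M * _]mulrC divfK//; lra.
Qed.

Lemma integral_dirac_within (Z : topologicalType) (z0 : Z) (S : set Z)
    (Phi : Z -> R) :
  closed S -> S z0 -> {within S, continuous Phi} ->
  (\int[dirac (z0 : borel z0)]_(z in S) (Phi z)%:E)%E = (Phi z0)%:E.
Proof.
move=> clS Sz0 cPhi.
have mS : measurable (S : set (borel z0)) by exact: borel_closed.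
rewrite integral_dirac//; first by rewrite diracE mem_set// mul1e.
by apply/measurable_EFinP; exact: within_continuous_measurable.
Qed.

Lemma weak_cvg_T m : weak_cvg_on (Q m)
  (fun k => rho_ omega Dn K h (m.+2 + k) m)
  (dirac (restr m h : borel (restr m h))).
Proof.
have clQ := Q_closed (m := m).
have hQ := restr_h_Q m.
split.
- move=> k; apply: nu_off_frontier => y Fy; apply.
  exact: (T_Q (leq_addr k m.+2) Fy).
- by rewrite diracE memNset//=; apply.
- move=> Phi cPhi; rewrite integral_dirac_within//.
  apply: (@cvg_comp _ _ _ (fun k => (m.+2 + k)%N)
    (fun n => (\int[rho_ omega Dn K h n m]_(z in Q m) (Phi z)%:E)%E) _ \oo).
    by apply: cvg_addnl.
  apply: (pushforward_integral_cvg (T := fun n => T_ n m) (N := m.+2)) => //.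
  + exact: Q_compact.
  + by move=> n y mn Fy; exact: T_Q.
  + by move=> n mn; apply: T_continuous; exact: leq_trans mn.
  + exact: T_cvg_in_probability.
Qed.

Lemma weak_cvg_TP : weak_cvg_on P (rho omega Dn K h)
  (dirac (restrP h : borel (restrP h))).
Proof.
have clP := P_closed.
have hP : P (restrP h).
  by move=> m; exact: restr_h_Q.
split.
- move=> k; apply: nu_off_frontier => y Fy; apply.
  exact: (TP_P Fy).
- by rewrite diracE memNset//=; apply.
- move=> Phi cPhi; rewrite integral_dirac_within//.
  apply: (pushforward_integral_cvg (T := TP) (N := 0)) => //.
  + exact: P_compact.
  + by move=> n y _ Fy; exact: TP_P.
  + by move=> n _; exact: TP_continuous.
  + exact: TP_cvg_in_probability.
Qed.

End exhaustion.

Theorem lemma4p6 (R : realType) (X : metricType R) (x0 : X)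
  (DD : set (set X))
  (omega : set X -> X -> {measure set (borel x0) -> \bar R})
  (D : set X) (Dn : nat -> set X) (K : nat -> X -> X -> R) (h : X -> R)
  (hframe : harmonic_framework DD omega)
  (hD : domain D) (hx0D : D x0)
  (hDn : forall n, DD (Dn n) /\ regular_for (Dn n) (omega (Dn n)))
  (hx0 : Dn 0%N x0)
  (hincr : forall n, relatively_compact_in (Dn n) (Dn n.+1))
  (hcup : D = \bigcup_n Dn n)
  (hK : forall n, continuous_kernel omega (Dn n) (K n))
  (hh : extreme_H1 DD omega D h) :
  (forall m : nat,
     weak_cvg_on (Q DD omega Dn K m)
       (fun k => rho_ omega Dn K h (m.+2 + k) m)
       (dirac (restr Dn m h : borel (restr Dn m h)))) /\
  weak_cvg_on (P DD omega Dn K)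
    (rho omega Dn K h)
    (dirac (restrP Dn h : borel (restrP Dn h))).
Proof.
split; first by move=> m; exact: (weak_cvg_T hframe hDn hx0 hincr hcup hK hh m).
exact: (weak_cvg_TP hframe hDn hx0 hincr hcup hK hh).
Qed.
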